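(* There exist a function $f\in H(\mathbb{D})$ and a non-empty open disc $D\subset \mathbb{C}\setminus \mathbb{D}$ such that the set $$\{S_n^{\overline{D}}(f):\,n\in \mathbb{N}\}\cup \{S_n^{\overline{D}}(-f):\,n\in \mathbb{N}\}$$ is dense in $A(\overline{D})$, while $f$ (and hence $-f$ too) is not a $\overline{D}$-universal Taylor series, i.e. $\{S_n^{\overline{D}}(f):\,n\in\mathbb{N}\}$ is not dense in $A(\overline{D})$.
   Context: $\mathbb{D}$ is the open unit disc of $\mathbb{C}$ and $H(\mathbb{D})$ is the space of holomorphic functions on $\mathbb{D}$. For a compact set $K\subset\mathbb{C}$, $A(K)$ is the Banach space of all continuous functions on $K$ that are holomorphic in the interior of $K$, endowed with the sup norm. For $f=\sum_{k\ge 0}a_kz^k\in H(\mathbb{D})$ and $n\in\mathbb{N}$, $S_n^{K}(f)\in A(K)$ denotes the restriction to $K$ of the polynomial $\sum_{k=0}^n a_kz^k$. A function $f\in H(\mathbb{D})$ is a $K$-universal Taylor series if $\{S_n^K(f):n\in\mathbb{N}\}$ is dense in $A(K)$. *)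

(* Defs.v *)
From Stdlib Require Import Reals ClassicalEpsilon.
From Coquelicot Require Import Coquelicot.

Open Scope R_scope.

(* Subsets of the complex plane are predicates [C -> Prop]; functions on a
   subset are total functions [C -> C] whose values elsewhere are irrelevant. *)

Definition open_disc (c : C) (r : R) : C -> Prop :=
  fun z => Cmod (z - c)%C < r.

Definition unit_disc : C -> Prop := open_disc (RtoC 0) 1.

Definition interior (K : C -> Prop) : C -> Prop := fun z => locally z K.

Definition closure (U : C -> Prop) : C -> Prop :=
  fun z => forall V : C -> Prop, locally z V -> exists w : C, V w /\ U w.

(* Complex differentiability at every point; [U] is meant to be open. *)
Definition holomorphic_on (U : C -> Prop) (f : C -> C) : Prop :=
  forall z : C, U z -> @ex_derive C_AbsRing C_NormedModule f z.

(* The elements of A(K), for K compact. *)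
Definition in_A (K : C -> Prop) (g : C -> C) : Prop :=
  continuous_on K g /\ holomorphic_on (interior K) g.

Definition sup_norm (K : C -> Prop) (h : C -> C) : Rbar :=
  Lub_Rbar (fun x : R => exists z : C, K z /\ x = Cmod (h z)).

Definition dense_in_A (K : C -> Prop) (E : (C -> C) -> Prop) : Prop :=
  forall g : C -> C, in_A K g ->
  forall eps : R, 0 < eps ->
  exists h : C -> C, E h /\ Rbar_lt (sup_norm K (fun z => (h z - g z)%C)) eps.

Definition is_taylor_expansion (f : C -> C) (a : nat -> C) : Prop :=
  forall z : C, unit_disc z -> @is_pseries C_AbsRing C_NormedModule a z (f z).

(* Coefficients of the expansion at 0; when f is holomorphic on the unit disc
   the expansion exists and is unique, so the choice is immaterial. *)
Definition taylor_coef (f : C -> C) : nat -> C :=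
  epsilon (inhabits (fun _ : nat => RtoC 0)) (is_taylor_expansion f).

Definition taylor_sum (n : nat) (f : C -> C) : C -> C :=
  fun z => sum_n (fun k => (taylor_coef f k * z ^ k)%C) n.

Definition taylor_sums (f : C -> C) : (C -> C) -> Prop :=
  fun p => exists n : nat, p = taylor_sum n f.

Definition universal_taylor_series (K : C -> Prop) (f : C -> C) : Prop :=
  dense_in_A K (taylor_sums f).

Lemma ex_derive_taylor_sum (n : nat) (f : C -> C) (z : C) :
  @ex_derive C_AbsRing C_NormedModule (taylor_sum n f) z.
Proof.
assert (Hpow : forall k, @ex_derive C_AbsRing (AbsRing_NormedModule C_AbsRing)
                           (fun w : C => (w ^ k)%C) z).
{ induction k as [|k [l IH]].
  - exists zero; apply (is_derive_const (K := C_AbsRing)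
      (V := AbsRing_NormedModule C_AbsRing) (RtoC 1)).
  - eexists.
    apply (is_derive_mult (K := C_AbsRing) (fun w : C => w)
             (fun w : C => (w ^ k)%C)).
    + apply is_derive_id.
    + exact IH.
    + intros x y; apply Cmult_comm. }
assert (Hterm : forall k, @ex_derive C_AbsRing (AbsRing_NormedModule C_AbsRing)
                  (fun w : C => (taylor_coef f k * w ^ k)%C) z).
{ intros k; destruct (Hpow k) as [l Hl].
  eexists.
  apply (is_derive_mult (K := C_AbsRing) (fun _ : C => taylor_coef f k)
           (fun w : C => (w ^ k)%C)).
  - apply (is_derive_const (K := C_AbsRing)
      (V := AbsRing_NormedModule C_AbsRing)).
  - exact Hl.
  - intros x y; apply Cmult_comm. }
assert (conv : forall g : C -> C,
  @ex_derive C_AbsRing (AbsRing_NormedModule C_AbsRing) g z ->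
  @ex_derive C_AbsRing C_NormedModule g z).
{ intros g [l [_ H]]; exists l; split.
  - apply is_linear_scal_l.
  - exact H. }
unfold taylor_sum.
induction n as [|n [l IH]].
- apply ex_derive_ext with (fun w : C => (taylor_coef f 0 * w ^ 0)%C).
  + intros w; symmetry; apply sum_O.
  + apply conv, Hterm.
- destruct (conv _ (Hterm (S n))) as [l' H'].
  exists (plus l l').
  apply is_derive_ext with
    (fun w : C => plus (sum_n (fun k => (taylor_coef f k * w ^ k)%C) n)
                       (taylor_coef f (S n) * w ^ (S n))%C).
  + intros w; symmetry; apply sum_Sn.
  + apply (is_derive_plus (V := C_NormedModule)); assumption.
Qed.

Lemma taylor_sum_in_A (K : C -> Prop) (n : nat) (f : C -> C) :
  in_A K (taylor_sum n f).
Proof.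
split.
- apply continuous_on_forall; intros z _ P HP.
  apply locally_C.
  exact (ex_derive_continuous _ z (ex_derive_taylor_sum n f z) P HP).
- intros z _; apply ex_derive_taylor_sum.
Qed.

(* Main.v *)
(* Work in the variable [w = z / 16] on the closed disc [|w - 1| <= 1/16]; the unit disc
   becomes [|w| < 1/16]. The series is built by successive polynomial extensions
     P  |->  P + w^a (T - P) q_a + L w^a (1 - w^M q_M),
   where [q_a] is a Taylor polynomial of [w^-a] at [1], so that [w^a q_a] is close to [1]
   near [w = 1] and has tiny coefficients with respect to the radius [1/16]. The middle
   term moves [P] to the target [T]; the last one disappears near [w = 1], but since
   [q_M] has integer coefficients, its partial sums at [w = 1] are integer multiples of
   the large constant [L] until they vanish, and they can vanish only once the middle
   term is complete. So at [w = 1] every partial sum is large or is close to the value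
   of an old or new target. Taking targets with [Re T(1) >= 0] keeps all partial sums
   of [f] away from the constant [-3], while every polynomial is, up to sign, such a
   target.

   Polynomials are dense in [A] of a closed disc: by Goursat's theorem on rectangles
   applied to [F (e^zeta) e^(-n zeta)], the Fourier coefficients of [F] on the circle
   of radius [rho] are [a_n rho^n], and [0] for [n < 0]; hence convolution on circles
   with a trigonometric kernel gives polynomials in [z], and a Korovkin estimate with
   the kernel [((1 + cos u) / 2)^N] gives uniform convergence. *)

Require Import Defs.
From Stdlib Require Import Reals ClassicalEpsilon.
From Coquelicot Require Import Coquelicot.
From Stdlib Require Import Lra Lia ZArith List Cantor.
Import ListNotations.

Open Scope R_scope.

(** * Polynomials as coefficient lists *)

(** Only the completed blocks are prescribed. Inside a block the middle term contributes partial
    sums at [w = 1] that are merely bounded by [pnorm 2 (T - P) * 8^a], so some of them could come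
    close to [-3]. To refute density all of them must be controlled, and this is done through one
    functional, evaluation at [w = 1], the centre [z = 16] of the disc. The radius [1/16] makes the
    masking affordable: the coefficients of [q_a] have total modulus at most [8^a], so [w^a q_a] has
    weight at most [2^-a] at that radius, whereas a constant [L] of order [16^a] placed at degree
    [a] still costs only a fixed fraction of [eps]. Hence [L] outgrows everything it has to hide.
    The union over both signs in the theorem comes from the half-plane [Re >= 0], which covers the
    plane together with its negative and yet misses a neighbourhood of [-3]. *)

Fixpoint peval (l : list C) (w : C) : C :=
  match l with nil => RtoC 0 | x :: l' => (x + w * peval l' w)%C end.

Fixpoint padd (l m : list C) : list C :=
  match l, m with
  | nil, _ => m
  | _, nil => l
  | x :: l', y :: m' => (x + y)%C :: padd l' m'
  end.

Definition pscal (c : C) (l : list C) : list C := map (Cmult c) l.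

Fixpoint pmul (l m : list C) : list C :=
  match l with nil => nil | x :: l' => padd (pscal x m) (RtoC 0 :: pmul l' m) end.

(** For [t >= 0] a weighted sum of moduli: it bounds the polynomial on the disc of radius [t], is
    submultiplicative, and does not grow under truncation, so it controls all partial sums at
    once. *)
Fixpoint pnorm (t : R) (l : list C) : R :=
  match l with nil => 0 | x :: l' => Cmod x + t * pnorm t l' end.

Definition pzero (n : nat) : list C := repeat (RtoC 0) n.

Lemma peval_padd l m w : peval (padd l m) w = (peval l w + peval m w)%C.
Proof.
revert m; induction l as [|x l IH]; intros [|y m]; simpl; try ring.
rewrite IH; ring.
Qed.

Lemma peval_pscal c l w : peval (pscal c l) w = (c * peval l w)%C.
Proof. induction l as [|x l IH]; simpl; [ring|rewrite IH; ring]. Qed.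

Lemma peval_pmul l m w : peval (pmul l m) w = (peval l w * peval m w)%C.
Proof.
induction l as [|x l IH]; simpl; [ring|].
rewrite peval_padd, peval_pscal; simpl; rewrite IH; ring.
Qed.

Lemma peval_app l m w : peval (l ++ m) w = (peval l w + w ^ length l * peval m w)%C.
Proof.
induction l as [|x l IH]; simpl; [ring|]; rewrite IH; ring.
Qed.

Lemma peval_pzero n w : peval (pzero n) w = RtoC 0.
Proof. induction n as [|n IH]; simpl; [easy|fold (pzero n); rewrite IH; ring]. Qed.

Lemma peval_shift n l w : peval (pzero n ++ l) w = (w ^ n * peval l w)%C.
Proof.
rewrite peval_app, peval_pzero; unfold pzero; rewrite repeat_length; ring.
Qed.

Lemma pnorm_ge0 t l : 0 <= t -> 0 <= pnorm t l.
Proof.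
intros Ht; induction l as [|x l IH]; simpl; [lra|].
pose proof (Cmod_ge_0 x); nra.
Qed.

Lemma pnorm_padd t l m : 0 <= t -> pnorm t (padd l m) <= pnorm t l + pnorm t m.
Proof.
intros Ht; revert m; induction l as [|x l IH]; intros [|y m]; simpl; try lra.
specialize (IH m); pose proof (Cmod_triangle x y).
assert (t * pnorm t (padd l m) <= t * (pnorm t l + pnorm t m)) by
  (apply Rmult_le_compat_l; assumption).
lra.
Qed.

Lemma pnorm_pscal t c l : pnorm t (pscal c l) = Cmod c * pnorm t l.
Proof. induction l as [|x l IH]; simpl; [ring|rewrite IH, Cmod_mult; ring]. Qed.

Lemma pnorm_pmul t l m : 0 <= t -> pnorm t (pmul l m) <= pnorm t l * pnorm t m.
Proof.
intros Ht; induction l as [|x l IH]; simpl; [lra|].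
eapply Rle_trans; [apply pnorm_padd, Ht|].
rewrite pnorm_pscal; simpl; rewrite Cmod_0.
assert (t * pnorm t (pmul l m) <= t * (pnorm t l * pnorm t m)) by
  (apply Rmult_le_compat_l; assumption).
lra.
Qed.

Lemma pnorm_app t l m : pnorm t (l ++ m) = pnorm t l + t ^ length l * pnorm t m.
Proof.
induction l as [|x l IH]; simpl; [ring|]; rewrite IH; ring.
Qed.

Lemma pnorm_pzero t n : pnorm t (pzero n) = 0.
Proof. induction n as [|n IH]; simpl; [easy|fold (pzero n); rewrite IH, Cmod_0; ring]. Qed.

Lemma pnorm_shift t n l : pnorm t (pzero n ++ l) = t ^ n * pnorm t l.
Proof.
rewrite pnorm_app, pnorm_pzero; unfold pzero; rewrite repeat_length; ring.
Qed.

Lemma pnorm_le t u l : 0 <= t <= u -> pnorm t l <= pnorm u l.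
Proof.
intros Ht; induction l as [|x l IH]; simpl; [lra|].
pose proof (pnorm_ge0 t l (proj1 Ht)).
assert (t * pnorm t l <= u * pnorm u l) by (apply Rmult_le_compat; lra).
lra.
Qed.

Lemma pnorm_firstn t n l : 0 <= t -> pnorm t (firstn n l) <= pnorm t l.
Proof.
intros Ht; rewrite <- (firstn_skipn n l) at 2; rewrite pnorm_app.
pose proof (pnorm_ge0 t (skipn n l) Ht); pose proof (pow_le t (length (firstn n l)) Ht).
nra.
Qed.

Lemma Cmod_peval_le l w t : Cmod w <= t -> Cmod (peval l w) <= pnorm t l.
Proof.
intros Hw; induction l as [|x l IH]; simpl; [rewrite Cmod_0; lra|].
eapply Rle_trans; [apply Cmod_triangle|]; rewrite Cmod_mult.
apply Rplus_le_compat_l, Rmult_le_compat; auto using Cmod_ge_0.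
Qed.

Lemma firstn_pzero n m : firstn n (pzero m) = pzero (min n m).
Proof.
revert m; induction n as [|n IH]; intros [|m]; simpl; try easy.
now fold (pzero m); rewrite IH.
Qed.

Lemma firstn_padd n l m : firstn n (padd l m) = padd (firstn n l) (firstn n m).
Proof.
revert l m; induction n as [|n IH]; intros [|x l] [|y m]; simpl; try easy.
now rewrite IH.
Qed.

Lemma firstn_pscal n c l : firstn n (pscal c l) = pscal c (firstn n l).
Proof. unfold pscal; apply firstn_map. Qed.

Definition is_intC (z : C) : Prop := exists k : Z, z = RtoC (IZR k).

Lemma is_intC_plus x y : is_intC x -> is_intC y -> is_intC (x + y).
Proof.
intros [k ->] [j ->]; exists (k + j)%Z; rewrite plus_IZR, RtoC_plus; easy.
Qed.

Lemma is_intC_mult x y : is_intC x -> is_intC y -> is_intC (x * y).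
Proof.
intros [k ->] [j ->]; exists (k * j)%Z; rewrite mult_IZR, RtoC_mult; easy.
Qed.

Lemma Forall_is_intC_padd l m :
  Forall is_intC l -> Forall is_intC m -> Forall is_intC (padd l m).
Proof.
intros Hl; revert m; induction Hl as [|x l Hx Hl IH]; intros [|y m] Hm; simpl; auto.
inversion Hm; subst; constructor; auto using is_intC_plus.
Qed.

Lemma Forall_is_intC_pscal c l :
  is_intC c -> Forall is_intC l -> Forall is_intC (pscal c l).
Proof.
intros Hc Hl; induction Hl; simpl; constructor; auto using is_intC_mult.
Qed.

Lemma Forall_is_intC_firstn n l : Forall is_intC l -> Forall is_intC (firstn n l).
Proof.
intros Hl; revert n; induction Hl; intros [|n]; simpl; auto.
Qed.

Lemma is_intC_peval_1 l : Forall is_intC l -> is_intC (peval l 1).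
Proof.
intros Hl; induction Hl; simpl; [now exists 0%Z|].
apply is_intC_plus; [assumption|apply is_intC_mult; [now exists 1%Z|assumption]].
Qed.

(** * Integer polynomials close to [w^-a] near 1 *)

Lemma Cmod_le_near_1 (w : C) (d : R) : Cmod (w - 1) <= d -> Cmod w <= 1 + d.
Proof.
intros H; replace w with (1 + (w - 1))%C by ring.
eapply Rle_trans; [apply Cmod_triangle|]; rewrite Cmod_1; lra.
Qed.

Lemma Cmod_sub_sym (x y : C) : Cmod (x - y) = Cmod (y - x).
Proof. rewrite <- Cmod_opp; f_equal; ring. Qed.

(* [q] is the degree-[K] Taylor polynomial of [w^-a] at [1], built by Pascal's rule. *)
Lemma taylor_inv_pow (a K : nat) :
  exists q : list C, Forall is_intC q /\ pnorm 1 q <= 2 ^ a * 4 ^ K /\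
    forall w : C, Cmod (w - 1) <= / 16 ->
      Cmod (1 - w ^ a * peval q w) <= 4 ^ a * (/ 8) ^ K.
Proof.
revert K; induction a as [|a IHa]; intros K.
{ exists [RtoC 1]; split; [|split].
  - constructor; [now exists 1%Z|constructor].
  - simpl; rewrite Cmod_1.
    pose proof (pow_R1_Rle 4 K ltac:(lra)); lra.
  - intros w _; simpl.
    replace (1 - 1 * (1 + w * 0))%C with (RtoC 0) by ring.
    rewrite Cmod_0; pose proof (pow_le (/ 8) K ltac:(lra)); lra. }
induction K as [|K [q2 [I2 [N2 E2]]]].
{ exists [RtoC 1]; split; [|split].
  - constructor; [now exists 1%Z|constructor].
  - cbn [pnorm pow]; rewrite Cmod_1; pose proof (pow_R1_Rle 2 a ltac:(lra)); lra.
  - intros w Hw; cbn [peval].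
    replace (1 - w ^ S a * (1 + w * 0))%C with (1 + - (w ^ S a))%C by ring.
    eapply Rle_trans; [apply Cmod_triangle|].
    rewrite Cmod_opp, Cmod_1, Cmod_pow.
    pose proof (Cmod_le_near_1 w _ Hw).
    assert (Cmod w ^ S a <= 2 ^ S a) by
      (apply pow_incr; split; [apply Cmod_ge_0|lra]).
    replace 4 with (2 * 2) by ring; rewrite Rpow_mult_distr.
    pose proof (pow_R1_Rle 2 (S a) ltac:(lra)).
    assert (2 <= 2 ^ S a) by (simpl; pose proof (pow_R1_Rle 2 a ltac:(lra)); lra).
    simpl pow at 4; nra. }
destruct (IHa (S K)) as [q1 [I1 [N1 E1]]].
(* [x] is [1 - w]; the recursion truncates [w^-(a+1) = w^-a + (1 - w) w^-(a+1)]. The bounds are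
   adapted to it: [2^a 4^(K+1) + 2 * 2^(a+1) 4^K = 2^(a+1) 4^(K+1)], and the factor
   [Cmod (w - 1) <= / 16] pays for the error. *)
set (x := [RtoC 1; (- (1))%C]).
exists (padd q1 (pmul x q2)).
assert (Ix : Forall is_intC (pmul x q2)).
{ unfold x; simpl; repeat apply Forall_is_intC_padd.
  - apply Forall_is_intC_pscal; [now exists 1%Z|assumption].
  - constructor; [now exists 0%Z|].
    apply Forall_is_intC_padd; [|repeat constructor; now exists 0%Z].
    apply Forall_is_intC_pscal; [exists (Z.opp 1); now rewrite opp_IZR, RtoC_opp|assumption]. }
split; [|split].
- now apply Forall_is_intC_padd.
- eapply Rle_trans; [apply pnorm_padd; lra|].
  pose proof (pnorm_pmul 1 x q2 ltac:(lra)) as Hm.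
  assert (Hx : pnorm 1 x = 2).
  { unfold x; simpl; rewrite Cmod_m1, Cmod_1; lra. }
  rewrite Hx in Hm; simpl in *; lra.
- intros w Hw; specialize (E1 w Hw); specialize (E2 w Hw).
  rewrite peval_padd, peval_pmul.
  replace (1 - w ^ S a * (peval q1 w + peval x w * peval q2 w))%C
    with (w * (1 - w ^ a * peval q1 w) + - (w - 1) * (1 - w ^ S a * peval q2 w))%C
    by (unfold x; simpl; ring).
  eapply Rle_trans; [apply Cmod_triangle|].
  rewrite !Cmod_mult, Cmod_opp.
  pose proof (Cmod_le_near_1 w _ Hw).
  assert (Cmod w * Cmod (1 - w ^ a * peval q1 w) <= (1 + / 16) * (4 ^ a * (/ 8) ^ S K))
    by (apply Rmult_le_compat; auto using Cmod_ge_0).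
  assert (Cmod (w - 1) * Cmod (1 - w ^ S a * peval q2 w) <= / 16 * (4 ^ S a * (/ 8) ^ K))
    by (apply Rmult_le_compat; auto using Cmod_ge_0).
  assert (0 <= 4 ^ a * (/ 8) ^ K) by (apply Rmult_le_pos; apply pow_le; lra).
  cbn [pow] in *; lra.
Qed.

(** Taking the degree equal to [a] makes both bounds geometric in [a]: the coefficient rate
    [2 * 4 = 8] stays below [16], and the error rate [4 / 8] below [1]. *)
Lemma taylor_inv_pow_diag (a : nat) :
  exists q : list C, Forall is_intC q /\ pnorm 1 q <= 8 ^ a /\
    forall w : C, Cmod (w - 1) <= / 16 ->
      Cmod (1 - w ^ a * peval q w) <= (/ 2) ^ a.
Proof.
destruct (taylor_inv_pow a a) as [q [I [N E]]].
exists q; split; [assumption|split].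
- replace 8 with (2 * 4) by ring; rewrite Rpow_mult_distr; exact N.
- intros w Hw; replace (/ 2) with (4 * / 8) by field.
  rewrite Rpow_mult_distr; now apply E.
Qed.

(** * One extension step *)

Lemma exists_half_pow_le (X eps : R) (N : nat) :
  0 < eps -> exists a : nat, (N <= a)%nat /\ X * (/ 2) ^ a <= eps.
Proof.
intros He.
destruct (pow_lt_1_zero (/ 2) ltac:(rewrite Rabs_pos_eq; lra) (eps / (Rabs X + 1)))
  as [n Hn].
{ apply Rdiv_lt_0_compat; [assumption|]; pose proof (Rabs_pos X); lra. }
exists (max N n); split; [lia|].
specialize (Hn (max N n) ltac:(lia)).
pose proof (pow_le (/ 2) (max N n) ltac:(lra)) as Hp.
rewrite Rabs_pos_eq in Hn by assumption.
pose proof (Rabs_pos X); pose proof (Rle_abs X).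
apply Rmult_lt_compat_r with (r := Rabs X + 1) in Hn; [|lra].
unfold Rdiv in Hn; rewrite Rmult_assoc, Rinv_l in Hn by lra.
nra.
Qed.

(* Values at [w = 1] that the partial sums are allowed to take: they stay away from [-3]. *)
Definition admissible (x : C) : Prop := 5 <= Cmod x \/ -1 <= Re x.

Definition admissible_sums (P : list C) : Prop :=
  forall m : nat, admissible (peval (firstn m P) 1).

Lemma Cmod_int_minus_1_ge (k : Z) : k <> 1%Z -> 1 <= Cmod (1 - RtoC (IZR k)).
Proof.
intros Hk; rewrite <- RtoC_minus, Cmod_R, <- minus_IZR, <- abs_IZR.
apply IZR_le; lia.
Qed.

(* The term [L w^a (1 - w^M qM(w))] is negligible on the disc, but at [w = 1] its
   partial sums are [L] times an integer, which can only vanish after the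
   correcting term [w^a (T - P) qa] has been completed. *)
Lemma extend_poly (P T : list C) (eps : R) :
  admissible_sums P -> 0 <= Re (peval T 1) -> 0 < eps <= 1 ->
  exists l : list C, l <> nil /\ admissible_sums (P ++ l) /\
    pnorm (/ 16) (P ++ l) <= pnorm (/ 16) P + eps /\
    forall w : C, Cmod (w - 1) <= / 16 ->
      Cmod (peval (P ++ l) w - peval T w) <= eps.
Proof.
intros HP HT Heps.
set (p := padd T (pscal (- (1)) P)).
set (n2 := pnorm 2 p).
assert (Hn2 : 0 <= n2) by (apply pnorm_ge0; lra).
assert (HnP : 0 <= pnorm 1 P) by (apply pnorm_ge0; lra).
(* This inequality serves twice: as it stands it bounds the error [n2 * (/ 2)^a] of the middle term,
   and multiplied by [16^a] it yields [n2 * 8^a + pnorm 1 P + 5 <= L]. *)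
destruct (exists_half_pow_le (5 + pnorm 1 P + n2) (eps / 4) (length P) ltac:(lra))
  as [a [HaN Ha]].
destruct (taylor_inv_pow_diag a) as [qa [_ [Nqa Eqa]]].
set (pq := pmul p qa).
set (L := eps / 4 * 16 ^ a).
assert (HL0 : 0 < L) by (apply Rmult_lt_0_compat; [lra|apply pow_lt; lra]).
(* [M] exceeds the length of the middle term [pq], so the mask cannot be lifted before [pq] is
   complete; it is also large enough for the mask to be small on the disc, where [w^a] is at most
   [2^a]. *)
destruct (exists_half_pow_le (L * 2 ^ a) (eps / 4) (S (length pq)) ltac:(lra))
  as [M [HMN HM]].
destruct (taylor_inv_pow_diag M) as [qM [IqM [NqM EqM]]].
set (h := pzero M ++ qM).
set (R1 := padd [RtoC 1] (pscal (- (1)) h)).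
set (b := padd (pscal (RtoC L) R1) pq).
set (l := pzero (a - length P) ++ b).
assert (Hpow2 : 0 < (/ 2) ^ a) by (apply pow_lt; lra).
assert (Hn2a : n2 * (/ 2) ^ a <= eps / 4).
{ eapply Rle_trans; [|exact Ha]; apply Rmult_le_compat_r; lra. }
assert (HpL : n2 * 8 ^ a + pnorm 1 P + 5 <= L).
{ unfold L; replace 16 with (8 * 2) by ring; rewrite Rpow_mult_distr.
  apply Rmult_le_compat_r with (r := 2 ^ a) in Ha; [|apply pow_le; lra].
  rewrite Rmult_assoc, <- Rpow_mult_distr, Rinv_l, pow1 in Ha by lra.
  pose proof (pow_R1_Rle 8 a ltac:(lra)).
  assert ((5 + pnorm 1 P + n2) * 8 ^ a <= eps / 4 * 2 ^ a * 8 ^ a)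
    by (apply Rmult_le_compat_r; lra).
  nra. }
assert (Hev : forall w, peval (P ++ l) w = (peval P w + w ^ a * peval b w)%C).
{ intros w; unfold l; rewrite peval_app, peval_shift, Cmult_assoc, <- Cpow_add_r.
  do 3 f_equal; lia. }
assert (Hp : forall w, peval p w = (peval T w - peval P w)%C).
{ intros w; unfold p; rewrite peval_padd, peval_pscal; ring. }
assert (Hpw : forall w, Cmod (w - 1) <= / 16 -> Cmod (peval p w) <= n2).
{ intros w Hw; apply Cmod_peval_le; pose proof (Cmod_le_near_1 w _ Hw); lra. }
assert (H11 : Cmod (1 - 1) <= / 16).
{ replace (1 - 1)%C with (RtoC 0) by ring; rewrite Cmod_0; lra. }
assert (Hpq1 : pnorm 1 pq <= n2 * 8 ^ a).
{ eapply Rle_trans; [apply pnorm_pmul; lra|].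
  apply Rmult_le_compat; try (apply pnorm_ge0; lra); [|assumption].
  apply pnorm_le; lra. }
exists l; split; [|split; [|split]].
- unfold l; intros H; apply app_eq_nil in H; destruct H as [_ H].
  unfold b, R1 in H; simpl in H.
  destruct (pscal (- (1)) h), pq; discriminate.
- intros m.
  (* Up to index [a] only zeros of the gap follow [P], and the value is that of a partial sum of
     [P]. *)
  destruct (Nat.le_gt_cases m a) as [Hma|Hma].
  { replace (peval (firstn m (P ++ l)) 1) with (peval (firstn m P) 1); [apply HP|].
    unfold l; rewrite firstn_app, firstn_app, peval_app, peval_app.
    replace (m - length P - length (pzero (a - length P)))%nat with 0%nat
      by (unfold pzero; rewrite repeat_length; lia).
    assert (Hz : firstn (m - length P) (pzero (a - length P)) = pzero (m - length P)).
    { rewrite firstn_pzero; f_equal; lia. }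
    rewrite Hz, peval_pzero; simpl; ring. }
  assert (Hf : peval (firstn m (P ++ l)) 1
               = (peval P 1 + peval (firstn (m - a) b) 1)%C).
  { unfold l; rewrite app_assoc, firstn_app.
    assert (Hlen : length (P ++ pzero (a - length P)) = a).
    { rewrite length_app; unfold pzero; rewrite repeat_length; lia. }
    rewrite Hlen, firstn_all2 by lia.
    rewrite 2!peval_app, peval_pzero, !Cpow_1_l; ring. }
  rewrite Hf; unfold b, R1.
  rewrite firstn_padd, firstn_pscal, firstn_padd, firstn_pscal.
  rewrite (firstn_all2 [RtoC 1]) by (simpl; lia).
  rewrite peval_padd, peval_pscal, peval_padd, peval_pscal.
  assert (Ih : Forall is_intC h).
  { unfold h; apply Forall_app; split; [|assumption].
    apply Forall_forall; intros x Hx; apply repeat_spec in Hx; subst; now exists 0%Z. }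
  (* The value becomes [P(1) + L (1 - k) + v], with [k] the value at 1 of the truncated [h] and [v]
     that of the truncated [pq]; the leading [1] of [R1] is present because [a < m]. *)
  destruct (is_intC_peval_1 _ (Forall_is_intC_firstn (m - a) h Ih)) as [k Hk].
  rewrite Hk.
  set (v := peval (firstn (m - a) pq) 1).
  assert (Hv : Cmod v <= n2 * 8 ^ a).
  { eapply Rle_trans; [apply Cmod_peval_le with (t := 1); rewrite Cmod_1; lra|].
    eapply Rle_trans; [apply pnorm_firstn; lra|assumption]. }
  assert (HvP : Cmod (peval P 1) <= pnorm 1 P)
    by (apply Cmod_peval_le; rewrite Cmod_1; lra).
  destruct (Z.eq_dec k 1) as [Hk1|Hk1].
  (* [h] starts with [M] zeros, so [k = 1] forces [m - a > M], beyond the length of [pq]. Then [v]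
     is complete and the value is within [eps / 4] of [T(1)]. *)
  + right; subst k.
    assert (HmM : (M < m - a)%nat).
    { destruct (Nat.le_gt_cases (m - a) M) as [Hle|]; [|assumption]; exfalso.
      revert Hk; unfold h; rewrite firstn_app.
      replace (m - a - length (pzero M))%nat with 0%nat
        by (unfold pzero; rewrite repeat_length; lia).
      rewrite firstn_pzero; simpl; rewrite app_nil_r, peval_pzero.
      intros H; apply RtoC_inj in H; lra. }
    unfold v; rewrite firstn_all2 by lia.
    unfold pq; rewrite peval_pmul, Hp; simpl peval.
    specialize (Eqa 1%C H11); rewrite Cpow_1_l in Eqa.
    specialize (Hpw 1%C H11); rewrite Hp in Hpw.
    set (u := (peval T 1 - peval P 1)%C) in *.
    replace (peval P 1 + (L * (1 + 1 * 0 + - (1) * 1) + u * peval qa 1))%C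
      with (peval T 1 + - (u * (1 - 1 * peval qa 1)))%C by (unfold u; ring).
    rewrite re_plus.
    assert (Cmod (- (u * (1 - 1 * peval qa 1))) <= eps / 4).
    { rewrite Cmod_opp, Cmod_mult; eapply Rle_trans; [|exact Hn2a].
      apply Rmult_le_compat; auto using Cmod_ge_0. }
    pose proof (re_le_Cmod (- (u * (1 - 1 * peval qa 1)))) as Hre.
    apply Rle_trans with (r3 := eps / 4) in Hre; [|assumption].
    apply Rabs_le_between in Hre; lra.
  (* [1 - k] is a nonzero integer, so the mask has modulus at least [L], which exceeds the other two
     terms together by at least [5]. *)
  + left; pose proof (Cmod_int_minus_1_ge k Hk1) as Hk2; simpl peval.
    set (y := (1 - RtoC (IZR k))%C) in *.
    assert (HLy : L <= Cmod (L * y)).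
    { rewrite Cmod_mult, Cmod_R, Rabs_pos_eq by lra; nra. }
    set (x := (peval P 1 + (L * (1 + 1 * 0 + - (1) * RtoC (IZR k)) + v))%C).
    assert (Hx : (L * y)%C = (x + (- peval P 1 + - v))%C) by (unfold x, y; ring).
    rewrite Hx in HLy.
    pose proof (Cmod_triangle x (- peval P 1 + - v)).
    pose proof (Cmod_triangle (- peval P 1) (- v)).
    rewrite !Cmod_opp in *; lra.
- assert (Hl : pnorm (/ 16) (P ++ l) = pnorm (/ 16) P + (/ 16) ^ a * pnorm (/ 16) b).
  { unfold l; rewrite pnorm_app, pnorm_shift, <- Rmult_assoc, <- pow_add.
    do 3 f_equal; lia. }
  rewrite Hl; apply Rplus_le_compat_l.
  assert (Hh : pnorm (/ 16) h <= 1).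
  { unfold h; rewrite pnorm_shift.
    apply Rle_trans with ((/ 16) ^ M * 8 ^ M).
    - apply Rmult_le_compat_l; [apply pow_le; lra|].
      eapply Rle_trans; [|exact NqM]; apply pnorm_le; lra.
    - rewrite <- Rpow_mult_distr, <- (pow1 M); apply pow_incr; lra. }
  assert (HR1 : pnorm (/ 16) R1 <= 2).
  { unfold R1; eapply Rle_trans; [apply pnorm_padd; lra|].
    rewrite pnorm_pscal, Cmod_m1; simpl; rewrite Cmod_1; lra. }
  assert (Hb : pnorm (/ 16) b <= L * 2 + n2 * 8 ^ a).
  { unfold b; eapply Rle_trans; [apply pnorm_padd; lra|].
    rewrite pnorm_pscal, Cmod_R, Rabs_pos_eq by lra.
    apply Rplus_le_compat; [apply Rmult_le_compat_l; lra|].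
    eapply Rle_trans; [|exact Hpq1]; apply pnorm_le; lra. }
  apply Rle_trans with ((/ 16) ^ a * (L * 2 + n2 * 8 ^ a)).
  { apply Rmult_le_compat_l; [apply pow_le; lra|assumption]. }
  (* The mask costs at most [eps / 2] because [R1] has weight at most [2]; the middle term costs
     [n2 * (/ 2)^a <= eps / 4]. *)
  unfold L.
  replace ((/ 16) ^ a * (eps / 4 * 16 ^ a * 2 + n2 * 8 ^ a))
    with (eps / 2 * ((/ 16) ^ a * 16 ^ a) + n2 * ((/ 16) ^ a * 8 ^ a)) by field.
  rewrite <- !Rpow_mult_distr.
  replace (/ 16 * 16) with 1 by field; replace (/ 16 * 8) with (/ 2) by field.
  rewrite pow1; lra.
- intros w Hw; rewrite Hev.
  specialize (Eqa w Hw); specialize (EqM w Hw); specialize (Hpw w Hw).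
  unfold b, R1, pq, h.
  rewrite peval_padd, peval_pscal, peval_padd, peval_pscal, peval_shift, peval_pmul.
  simpl (peval [RtoC 1] w).
  replace (peval P w +
     w ^ a * (L * (1 + w * 0 + - (1) * (w ^ M * peval qM w)) + peval p w * peval qa w)
     - peval T w)%C
    with (L * (w ^ a * (1 - w ^ M * peval qM w)) + - (peval p w * (1 - w ^ a * peval qa w)))%C
    by (rewrite Hp; ring).
  eapply Rle_trans; [apply Cmod_triangle|].
  rewrite Cmod_opp, !Cmod_mult, Cmod_R, Rabs_pos_eq by lra.
  assert (Hwa : Cmod (w ^ a) <= 2 ^ a).
  { rewrite Cmod_pow; apply pow_incr; split; [apply Cmod_ge_0|].
    pose proof (Cmod_le_near_1 w _ Hw); lra. }
  assert (Cmod (peval p w) * Cmod (1 - w ^ a * peval qa w) <= eps / 4).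
  { eapply Rle_trans; [|exact Hn2a]; apply Rmult_le_compat; auto using Cmod_ge_0. }
  assert (L * (Cmod (w ^ a) * Cmod (1 - w ^ M * peval qM w)) <= eps / 4).
  { eapply Rle_trans; [|exact HM]; rewrite Rmult_assoc.
    apply Rmult_le_compat_l; [lra|]; apply Rmult_le_compat; auto using Cmod_ge_0. }
  lra.
Qed.

(** * Construction of the coefficients *)

(** The values are exactly the rationals; naturals as parameters let Cantor pairing enumerate the
    polynomials with complex rational coefficients. *)
Definition nat_quotient (a b m : nat) : R := (INR a - INR b) / (INR m + 1).

Definition coef_code : Type := (nat * nat * nat * nat * nat)%type.

Definition decode_coef (c : coef_code) : C :=
  match c with (a, b, c, d, m) => (nat_quotient a b m, nat_quotient c d m) end.

Definition encode_coef (c : coef_code) : nat :=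
  match c with (a, b, c, d, m) =>
    Cantor.to_nat (a, Cantor.to_nat (b, Cantor.to_nat (c, Cantor.to_nat (d, m)))) end.

Fixpoint encode_coefs (s : list coef_code) : nat :=
  match s with nil => 0 | c :: s => S (Cantor.to_nat (encode_coef c, encode_coefs s)) end.

Lemma encode_coef_inj (c c' : coef_code) : encode_coef c = encode_coef c' -> c = c'.
Proof.
destruct c as [[[[? ?] ?] ?] ?], c' as [[[[? ?] ?] ?] ?]; unfold encode_coef; intros H.
do 4 (apply Cantor.to_nat_inj, pair_equal_spec in H; destruct H as [-> H]).
now rewrite H.
Qed.

Lemma encode_coefs_inj (s s' : list coef_code) : encode_coefs s = encode_coefs s' -> s = s'.
Proof.
revert s'; induction s as [|c s IH]; intros [|c' s']; cbn [encode_coefs]; intros H;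
  try discriminate; [easy|].
apply Nat.succ_inj, Cantor.to_nat_inj, pair_equal_spec in H; destruct H as [H1 H2].
f_equal; [now apply encode_coef_inj|now apply IH].
Qed.

Definition encode (c : nat * list coef_code) : nat :=
  Cantor.to_nat (fst c, encode_coefs (snd c)).

(** A left inverse of the injection [encode], by choice; outside its range the value is arbitrary.
    The first entry of a pair prescribes a precision, the second a polynomial. *)
Definition decode (n : nat) : nat * list coef_code :=
  epsilon (inhabits (0%nat, nil)) (fun c => encode c = n).

Lemma decode_surj (c : nat * list coef_code) : exists n : nat, decode n = c.
Proof.
exists (encode c).
assert (H : encode (decode (encode c)) = encode c)
  by (apply epsilon_spec with (P := fun c' => encode c' = encode c); now exists c).
unfold encode at 1 3 in H; apply Cantor.to_nat_inj, pair_equal_spec in H.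
destruct H as [H1 H2]; apply encode_coefs_inj in H2.
revert H1 H2; destruct (decode (encode c)), c; simpl; congruence.
Qed.

Definition decode_poly (s : list coef_code) : list C := map decode_coef s.

Definition flip (P : list C) : list C :=
  if Rle_dec 0 (Re (peval P 1)) then P else pscal (- (1)) P.

Lemma Re_flip_ge0 (P : list C) : 0 <= Re (peval (flip P) 1).
Proof.
unfold flip; destruct (Rle_dec 0 (Re (peval P 1))); [assumption|].
rewrite peval_pscal.
replace (- (1) * peval P 1)%C with (- peval P 1)%C by ring.
rewrite re_opp; lra.
Qed.

Definition target (n : nat) : list C :=
  flip (decode_poly (snd (decode n))).

(** The power of [/ 2] keeps the total weight of the extensions bounded. The other term is read from
    the code: each polynomial is paired with every precision, so it is approximated arbitrarily
    well. *)
Definition tolerance (n : nat) : R :=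
  Rmin ((/ 2) ^ n) (/ (INR (fst (decode n)) + 1)).

Lemma tolerance_bounds (n : nat) : 0 < tolerance n <= (/ 2) ^ n.
Proof.
unfold tolerance; split; [|apply Rmin_l].
apply Rmin_glb_lt; [apply pow_lt; lra|].
apply Rinv_0_lt_compat; pose proof (pos_INR (fst (decode n))); lra.
Qed.

Definition extension_of (P T : list C) (eps : R) (l : list C) : Prop :=
  l <> nil /\ admissible_sums (P ++ l) /\
  pnorm (/ 16) (P ++ l) <= pnorm (/ 16) P + eps /\
  forall w : C, Cmod (w - 1) <= / 16 -> Cmod (peval (P ++ l) w - peval T w) <= eps.

Fixpoint stage (n : nat) : list C :=
  match n with
  | O => nil
  | S n => stage n ++ epsilon (inhabits nil) (extension_of (stage n) (target n) (tolerance n))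
  end.

(** Admissibility of one stage is what makes the next choice in [stage] legitimate, so both are
    carried along together. [2 - 2 * (/ 2)^n] is the sum of the bounds [(/ 2)^k] for [k < n]. *)
Lemma stage_spec (n : nat) :
  admissible_sums (stage n) /\ pnorm (/ 16) (stage n) <= 2 - 2 * (/ 2) ^ n /\
  exists l, stage (S n) = stage n ++ l /\ extension_of (stage n) (target n) (tolerance n) l.
Proof.
assert (Hstep : forall n, admissible_sums (stage n) ->
  exists l, stage (S n) = stage n ++ l /\ extension_of (stage n) (target n) (tolerance n) l).
{ intros k Hk; eexists; split; [reflexivity|].
  apply epsilon_spec; apply extend_poly; [assumption| |].
  - apply Re_flip_ge0.
  - pose proof (tolerance_bounds k).
    assert ((/ 2) ^ k <= 1) by (rewrite <- (pow1 k); apply pow_incr; lra); lra. }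
assert (Hinv : admissible_sums (stage n) /\ pnorm (/ 16) (stage n) <= 2 - 2 * (/ 2) ^ n).
{ induction n as [|n [IH1 IH2]].
  - split; [|simpl; lra].
    intros m; right; rewrite firstn_nil; simpl; lra.
  - destruct (Hstep n IH1) as [l [-> [_ [H1 [H2 _]]]]]; split; [assumption|].
    pose proof (tolerance_bounds n); simpl; lra. }
destruct Hinv; auto.
Qed.

Lemma stage_prefix (n j : nat) : exists l, stage (n + j) = stage n ++ l.
Proof.
induction j as [|j [l IH]].
- exists nil; rewrite app_nil_r; f_equal; lia.
- rewrite Nat.add_succ_r.
  destruct (stage_spec (n + j)) as [_ [_ [l' [-> _]]]].
  exists (l ++ l'); rewrite IH, app_assoc; reflexivity.
Qed.

Lemma stage_length (n : nat) : (n <= length (stage n))%nat.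
Proof.
induction n as [|n IH]; [lia|].
destruct (stage_spec n) as [_ [_ [l [-> [Hl _]]]]].
rewrite length_app; destruct l; [easy|simpl; lia].
Qed.

(** [stage (S k)] has at least [S k] entries, so the default [0] is never read. *)
Definition limit_coef (k : nat) : C := nth k (stage (S k)) 0.

Definition truncation (a : nat -> C) (n : nat) : list C := map a (seq 0 n).

Lemma nth_stage (n k : nat) : (k < length (stage n))%nat -> nth k (stage n) 0 = limit_coef k.
Proof.
intros Hk; unfold limit_coef; pose proof (stage_length (S k)).
destruct (stage_prefix n (S k)) as [l Hl], (stage_prefix (S k) n) as [l' Hl'].
rewrite Nat.add_comm, Hl in Hl'.
apply (f_equal (fun l => nth k l (RtoC 0))) in Hl'.
now rewrite !app_nth1 in Hl' by lia.
Qed.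

Lemma truncation_limit_coef (n m : nat) :
  (m <= length (stage n))%nat -> truncation limit_coef m = firstn m (stage n).
Proof.
intros Hm; apply nth_ext with (d := RtoC 0) (d' := RtoC 0).
- unfold truncation; rewrite length_map, length_seq, length_firstn; lia.
- unfold truncation; rewrite length_map, length_seq; intros k Hk.
  rewrite nth_indep with (d' := limit_coef 0) by (rewrite length_map, length_seq; lia).
  rewrite map_nth, seq_nth, nth_firstn by lia.
  destruct (Nat.ltb_spec k m); [|lia].
  rewrite nth_stage by lia; reflexivity.
Qed.

Lemma exists_nat_quotient (x y eps : R) : 0 < eps ->
  exists a b c d m : nat,
    Rabs (x - nat_quotient a b m) <= eps /\ Rabs (y - nat_quotient c d m) <= eps.
Proof.
intros He.
destruct (archimed_cor1 eps He) as [m [Hm Hm0]].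
assert (Hone : forall t : R, exists a b : nat, Rabs (t - nat_quotient a b m) <= eps).
{ intros t; set (k := up (t * (INR m + 1))).
  exists (Z.to_nat k), (Z.to_nat (- k)); unfold nat_quotient.
  replace (INR (Z.to_nat k) - INR (Z.to_nat (- k))) with (IZR k).
  2:{ rewrite !INR_IZR_INZ, <- minus_IZR; f_equal; lia. }
  destruct (archimed (t * (INR m + 1))) as [H1 H2]; fold k in H1, H2.
  assert (HN : 0 < INR m) by (apply lt_0_INR; lia).
  assert (Hinv : / (INR m + 1) <= eps).
  { eapply Rle_trans; [|left; exact Hm]; apply Rinv_le_contravar; lra. }
  replace (t - IZR k / (INR m + 1))
    with (- ((IZR k - t * (INR m + 1)) * / (INR m + 1))) by (field; lra).
  rewrite Rabs_Ropp, Rabs_mult.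
  assert (0 < / (INR m + 1)) by (apply Rinv_0_lt_compat; lra).
  rewrite !Rabs_pos_eq by lra.
  apply Rle_trans with (1 * / (INR m + 1)); [apply Rmult_le_compat_r; lra|lra]. }
destruct (Hone x) as [a [b Hx]], (Hone y) as [c [d Hy]].
now exists a, b, c, d, m.
Qed.

(** By Horner's form: the head costs [eps / 2], and a tail error of [eps / 4] is at most doubled by
    [w]. *)
Lemma decode_poly_dense (p : list C) (eps : R) : 0 < eps ->
  exists s : list coef_code, forall w : C, Cmod w <= 2 ->
    Cmod (peval (decode_poly s) w - peval p w) <= eps.
Proof.
revert eps; induction p as [|x p IH]; intros eps He.
- exists nil; intros w _; simpl.
  unfold Cminus; rewrite Cplus_opp_r, Cmod_0; lra.
- destruct (IH (eps / 4) ltac:(lra)) as [s Hs].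
  destruct (exists_nat_quotient (fst x) (snd x) (eps / 4) ltac:(lra))
    as [a [b [c [d [m [H1 H2]]]]]].
  exists ((a, b, c, d, m) :: s); intros w Hw; specialize (Hs w Hw).
  unfold decode_poly; simpl map; fold (decode_poly s); simpl peval.
  set (u := (nat_quotient a b m, nat_quotient c d m) : C).
  replace (u + w * peval (decode_poly s) w - (x + w * peval p w))%C
    with (- (x - u) + w * (peval (decode_poly s) w - peval p w))%C by ring.
  eapply Rle_trans; [apply Cmod_triangle|]; rewrite Cmod_opp, Cmod_mult.
  assert (Cmod (x - u) <= eps / 2).
  { replace (x - u)%C with (RtoC (fst x - nat_quotient a b m)
                            + Ci * RtoC (snd x - nat_quotient c d m))%C.
    - eapply Rle_trans; [apply Cmod_triangle|].
      rewrite Cmod_mult, Cmod_Ci, !Cmod_R; lra.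
    - destruct x as [x1 x2]; unfold u, Ci, RtoC, Cplus, Cmult, Cminus, Copp.
      apply injective_projections; simpl; ring. }
  assert (Cmod w * Cmod (peval (decode_poly s) w - peval p w) <= 2 * (eps / 4))
    by (apply Rmult_le_compat; auto using Cmod_ge_0).
  lra.
Qed.

(** The three clauses serve convergence on the unit disc, failure of universality, and density up to
    sign. [S n] coefficients make up the partial sum of degree [n]. *)
Lemma exists_half_universal_coefs :
  exists A : nat -> C,
    (forall n, pnorm (/ 16) (truncation A n) <= 2) /\
    (forall n, admissible (peval (truncation A n) 1)) /\
    (forall (p : list C) (eps : R), 0 < eps ->
      exists n, exists sg : C, (sg = RtoC 1 \/ sg = (- (1))%C) /\
      forall w : C, Cmod (w - 1) <= / 16 ->
        Cmod (sg * peval (truncation A (S n)) w - peval p w) <= eps).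
Proof.
exists limit_coef; split; [|split].
- intros n; rewrite (truncation_limit_coef n n (stage_length n)).
  eapply Rle_trans; [apply pnorm_firstn; lra|].
  destruct (stage_spec n) as [_ [H _]]; pose proof (pow_le (/ 2) n ltac:(lra)); lra.
- intros n; rewrite (truncation_limit_coef n n (stage_length n)).
  apply (stage_spec n).
- intros p eps He.
  destruct (decode_poly_dense p (eps / 2) ltac:(lra)) as [s Hs].
  destruct (archimed_cor1 (eps / 2) ltac:(lra)) as [j [Hj Hj0]].
  destruct (decode_surj (j, s)) as [n Hn].
  destruct (stage_spec n) as [_ [_ [l [Hl [_ [_ [_ Hext]]]]]]].
  rewrite <- Hl in Hext.
  pose proof (stage_length (S n)) as Hlen.
  exists (pred (length (stage (S n)))).
  rewrite Nat.succ_pred by lia.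
  rewrite (truncation_limit_coef (S n) _ (Nat.le_refl _)), firstn_all.
  assert (Htol : tolerance n <= eps / 2).
  { unfold tolerance; rewrite Hn; simpl fst; eapply Rle_trans; [apply Rmin_r|].
    eapply Rle_trans; [|left; exact Hj].
    apply Rinv_le_contravar; [apply lt_0_INR; lia|lra]. }
  assert (Htar : exists sg : C, (sg = RtoC 1 \/ sg = (- (1))%C) /\
            forall w, peval (target n) w = (sg * peval (decode_poly s) w)%C).
  { unfold target, flip; rewrite Hn; simpl snd.
    destruct (Rle_dec 0 (Re (peval (decode_poly s) 1))).
    - exists (RtoC 1); split; [auto|intros w; ring].
    - exists (- (1))%C; split; [auto|intros w; apply peval_pscal]. }
  destruct Htar as [sg [Hsg Htar]]; exists sg; split; [assumption|].
  intros w Hw; specialize (Hext w Hw); rewrite Htar in Hext.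
  assert (Hw2 : Cmod w <= 2) by (pose proof (Cmod_le_near_1 w _ Hw); lra).
  specialize (Hs w Hw2).
  (* Since [sg] is its own inverse, the sign that [flip] put on the target moves to the partial
     sum. *)
  assert (Hs2 : (sg * sg)%C = RtoC 1) by (destruct Hsg; subst; ring).
  assert (Hs1 : Cmod sg = 1) by (destruct Hsg; subst; [apply Cmod_1|apply Cmod_m1]).
  replace (sg * peval (stage (S n)) w - peval p w)%C
    with (sg * (peval (stage (S n)) w - sg * peval (decode_poly s) w)
          + ((sg * sg) * peval (decode_poly s) w - peval p w))%C by ring.
  rewrite Hs2, Cmult_1_l.
  eapply Rle_trans; [apply Cmod_triangle|]; rewrite Cmod_mult, Hs1; lra.
Qed.

(** * Complex line integrals and Goursat's theorem *)

Lemma Cmod_le_abs (z : C) : Cmod z <= Rabs (fst z) + Rabs (snd z).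
Proof.
destruct z as [x y].
replace ((x, y) : C) with (RtoC x + Ci * RtoC y)%C
  by (apply injective_projections; simpl; ring).
eapply Rle_trans; [apply Cmod_triangle|].
rewrite Cmod_mult, Cmod_Ci, !Cmod_R; simpl.
rewrite !Rmult_0_l, !Rmult_0_r, !Rmult_1_l, Rminus_0_r, !Rplus_0_l, Rplus_0_r.
lra.
Qed.

Lemma Cmod_minus_le (x y : C) : Cmod (x - y) <= Cmod x + Cmod y.
Proof. rewrite <- (Cmod_opp y); apply Cmod_triangle. Qed.

Lemma abs_fst_le (z : C) : Rabs (fst z) <= Cmod z.
Proof. eapply Rle_trans; [apply Rmax_l|apply Rmax_Cmod]. Qed.

Lemma abs_snd_le (z : C) : Rabs (snd z) <= Cmod z.
Proof. eapply Rle_trans; [apply Rmax_r|apply Rmax_Cmod]. Qed.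

(** Continuity by components, the form in which [Cint], a pair of real integrals, uses it. *)
Definition ccont (f : R -> C) (t : R) : Prop :=
  continuous (fun u => fst (f u)) t /\ continuous (fun u => snd (f u)) t.

Definition ccont_on (f : R -> C) (a b : R) : Prop := forall t, a <= t <= b -> ccont f t.

Lemma ccont_const (c : C) t : ccont (fun _ => c) t.
Proof. split; apply continuous_const. Qed.

Lemma ccont_plus f g t : ccont f t -> ccont g t -> ccont (fun u => (f u + g u)%C) t.
Proof.
intros [F1 F2] [G1 G2]; split; simpl.
- now apply (continuous_plus (fun u => fst (f u)) (fun u => fst (g u))).
- now apply (continuous_plus (fun u => snd (f u)) (fun u => snd (g u))).
Qed.

Lemma ccont_mult f g t : ccont f t -> ccont g t -> ccont (fun u => (f u * g u)%C) t.
Proof.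
intros [F1 F2] [G1 G2]; split; simpl.
- apply (continuous_minus (fun u => fst (f u) * fst (g u)) (fun u => snd (f u) * snd (g u)));
    apply (continuous_mult (K := R_AbsRing)); assumption.
- apply (continuous_plus (fun u => fst (f u) * snd (g u)) (fun u => snd (f u) * fst (g u)));
    apply (continuous_mult (K := R_AbsRing)); assumption.
Qed.

Lemma ccont_opp f t : ccont f t -> ccont (fun u => (- f u)%C) t.
Proof.
intros [F1 F2]; split; simpl.
- now apply (continuous_opp (fun u => fst (f u))).
- now apply (continuous_opp (fun u => snd (f u))).
Qed.

Lemma ccont_minus f g t : ccont f t -> ccont g t -> ccont (fun u => (f u - g u)%C) t.
Proof. intros Hf Hg; apply ccont_plus; [assumption|now apply ccont_opp]. Qed.

Lemma ccont_RtoC (f : R -> R) t : continuous f t -> ccont (fun u => RtoC (f u)) t.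
Proof. intros Hf; split; simpl; [assumption|apply continuous_const]. Qed.

Lemma ccont_peval l f t : ccont f t -> ccont (fun u => peval l (f u)) t.
Proof.
intros Hf; induction l as [|x l IH]; simpl; [apply ccont_const|].
apply ccont_plus; [apply ccont_const|now apply ccont_mult].
Qed.

Lemma ccont_eps (f : R -> C) (t : R) :
  (forall eps, 0 < eps -> exists d, 0 < d /\
     forall u, Rabs (u - t) < d -> Cmod (f u - f t) < eps) -> ccont f t.
Proof.
intros H; split; apply continuity_pt_filterlim; intros eps He;
  destruct (H eps He) as [d [Hd Hf]]; exists d; split; try assumption;
  intros u [_ Hu]; simpl in *; unfold Rdist in *;
  (eapply Rle_lt_trans; [|apply (Hf u Hu)]).
- exact (abs_fst_le (f u - f t)).
- exact (abs_snd_le (f u - f t)).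
Qed.

Definition Cint (f : R -> C) (a b : R) : C :=
  (RInt (fun t => fst (f t)) a b, RInt (fun t => snd (f t)) a b).

Lemma ex_RInt_cont (f : R -> R) a b :
  a <= b -> (forall t, a <= t <= b -> continuous f t) -> ex_RInt f a b.
Proof.
intros Hab H; apply (ex_RInt_continuous (V := R_CompleteNormedModule)).
intros t; rewrite Rmin_left, Rmax_right by assumption; apply H.
Qed.

Lemma Cint_ex f a b : a <= b -> ccont_on f a b ->
  ex_RInt (fun t => fst (f t)) a b /\ ex_RInt (fun t => snd (f t)) a b.
Proof. intros Hab H; split; apply ex_RInt_cont; try assumption; apply H. Qed.

Lemma Cint_ext f g a b : a <= b ->
  (forall t, a <= t <= b -> f t = g t) -> Cint f a b = Cint g a b.
Proof.
intros Hab H; unfold Cint; f_equal; apply RInt_ext; intros t;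
  rewrite Rmin_left, Rmax_right by assumption; intros Ht; rewrite H by lra; reflexivity.
Qed.

Lemma Cint_plus f g a b : a <= b -> ccont_on f a b -> ccont_on g a b ->
  Cint (fun t => (f t + g t)%C) a b = (Cint f a b + Cint g a b)%C.
Proof.
intros Hab Hf Hg.
destruct (Cint_ex f a b Hab Hf) as [F1 F2], (Cint_ex g a b Hab Hg) as [G1 G2].
apply injective_projections; simpl.
- exact (RInt_plus _ _ a b F1 G1).
- exact (RInt_plus _ _ a b F2 G2).
Qed.

Lemma Cint_scal c f a b : a <= b -> ccont_on f a b ->
  Cint (fun t => (c * f t)%C) a b = (c * Cint f a b)%C.
Proof.
intros Hab Hf.
destruct (Cint_ex f a b Hab Hf) as [F1 F2].
apply injective_projections; simpl.
- rewrite (RInt_minus (V := R_CompleteNormedModule) (fun t => fst c * fst (f t)) (fun t => snd c * snd (f t)));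
    try (apply (ex_RInt_scal (V := R_NormedModule)); assumption).
  unfold minus, plus, opp; simpl; unfold Rminus; f_equal; [|f_equal];
    apply (RInt_scal (V := R_CompleteNormedModule)); assumption.
- rewrite (RInt_plus (V := R_CompleteNormedModule) (fun t => fst c * snd (f t)) (fun t => snd c * fst (f t)));
    try (apply (ex_RInt_scal (V := R_NormedModule)); assumption).
  unfold plus; simpl; f_equal;
    apply (RInt_scal (V := R_CompleteNormedModule)); assumption.
Qed.

Lemma Cint_minus f g a b : a <= b -> ccont_on f a b -> ccont_on g a b ->
  Cint (fun t => (f t - g t)%C) a b = (Cint f a b - Cint g a b)%C.
Proof.
intros Hab Hf Hg.
rewrite (Cint_ext _ (fun t => (f t + (- (1)) * g t)%C)) by (try assumption; intros; ring).
rewrite Cint_plus, Cint_scal; try assumption; [ring|].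
intros t Ht; apply ccont_mult; [apply ccont_const|now apply Hg].
Qed.

Lemma Cint_Chasles f a b c : a <= b <= c -> ccont_on f a c ->
  (Cint f a b + Cint f b c)%C = Cint f a c.
Proof.
intros Habc Hf.
assert (H1 : ccont_on f a b) by (intros t Ht; apply Hf; lra).
assert (H2 : ccont_on f b c) by (intros t Ht; apply Hf; lra).
destruct (Cint_ex f a b ltac:(lra) H1), (Cint_ex f b c ltac:(lra) H2).
apply injective_projections; simpl; apply (RInt_Chasles (V := R_CompleteNormedModule)); assumption.
Qed.

(** The factor [2] is the price of estimating real and imaginary parts separately; both later uses,
    Goursat's theorem and the kernel estimate, can afford it. *)
Lemma Cmod_Cint_le f (M : R -> R) a b : a <= b -> ccont_on f a b ->
  (forall t, a <= t <= b -> continuous M t) ->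
  (forall t, a <= t <= b -> Cmod (f t) <= M t) ->
  Cmod (Cint f a b) <= 2 * RInt M a b.
Proof.
intros Hab Hf HM HfM.
destruct (Cint_ex f a b Hab Hf) as [F1 F2].
assert (HMi : ex_RInt M a b) by now apply ex_RInt_cont.
assert (Hone : forall g : R -> R, ex_RInt g a b ->
  (forall t, a <= t <= b -> Rabs (g t) <= M t) -> Rabs (RInt g a b) <= RInt M a b).
{ intros g Hg Hgm.
  apply (norm_RInt_le (V := R_NormedModule) g M a b); try assumption;
    apply (RInt_correct (V := R_CompleteNormedModule)); assumption. }
eapply Rle_trans; [apply Cmod_le_abs|].
replace (2 * RInt M a b) with (RInt M a b + RInt M a b) by ring.
apply Rplus_le_compat; apply Hone; try assumption; intros t Ht;
  (eapply Rle_trans; [|now apply HfM]); [apply abs_fst_le|apply abs_snd_le].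
Qed.

Lemma Cmod_Cint_le_const f M a b : a <= b -> ccont_on f a b ->
  (forall t, a <= t <= b -> Cmod (f t) <= M) -> Cmod (Cint f a b) <= 2 * (M * (b - a)).
Proof.
intros Hab Hf HM.
replace (M * (b - a)) with (RInt (fun _ => M) a b)
  by (rewrite RInt_const; unfold scal; simpl; unfold mult; simpl; ring).
apply Cmod_Cint_le; try assumption; intros; apply continuous_const.
Qed.

Lemma is_RInt_id a b : is_RInt (fun t : R => t) a b ((b ^ 2 - a ^ 2) / 2).
Proof.
replace ((b ^ 2 - a ^ 2) / 2) with (minus (b ^ 2 / 2) (a ^ 2 / 2))
  by (unfold minus, plus, opp; simpl; field).
apply (is_RInt_derive (fun t => t ^ 2 / 2) (fun t => t)); intros t _.
- auto_derive; [easy|field].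
- apply continuous_id.
Qed.

Definition cdiff (f : C -> C) (z : C) : Prop :=
  exists B : C, forall eps, 0 < eps -> exists d, 0 < d /\
    forall w, Cmod (w - z) < d -> Cmod (f w - f z - B * (w - z)) <= eps * Cmod (w - z).

Lemma cdiff_continuous f z eps : cdiff f z -> 0 < eps ->
  exists d, 0 < d /\ forall w, Cmod (w - z) < d -> Cmod (f w - f z) < eps.
Proof.
intros [B HB] He.
destruct (HB 1 ltac:(lra)) as [d [Hd H]].
pose proof (Cmod_ge_0 B) as HB0.
exists (Rmin d (eps / (2 + Cmod B))); split.
{ apply Rmin_glb_lt; [assumption|apply Rdiv_lt_0_compat; lra]. }
intros w Hw.
assert (Hw1 : Cmod (w - z) < d) by (eapply Rlt_le_trans; [exact Hw|apply Rmin_l]).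
assert (Hw2 : Cmod (w - z) < eps / (2 + Cmod B))
  by (eapply Rlt_le_trans; [exact Hw|apply Rmin_r]).
specialize (H w Hw1).
replace (f w - f z)%C with ((f w - f z - B * (w - z)) + B * (w - z))%C by ring.
eapply Rle_lt_trans; [apply Cmod_triangle|]; rewrite Cmod_mult.
apply Rmult_lt_compat_r with (r := 2 + Cmod B) in Hw2; [|lra].
unfold Rdiv in Hw2; rewrite Rmult_assoc, Rinv_l in Hw2 by lra.
pose proof (Cmod_ge_0 (w - z)); nra.
Qed.

Lemma ccont_horizontal f x y : cdiff f (x, y) -> ccont (fun s => f (s, y)) x.
Proof.
intros H; apply ccont_eps; intros eps He.
destruct (cdiff_continuous f (x, y) eps H He) as [d [Hd Hf]].
exists d; split; [assumption|]; intros u Hu; apply Hf.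
eapply Rle_lt_trans; [apply Cmod_le_abs|]; simpl.
replace (y + - y) with 0 by ring; rewrite Rabs_R0; unfold Rminus in Hu; lra.
Qed.

Lemma ccont_vertical f x y : cdiff f (x, y) -> ccont (fun t => f (x, t)) y.
Proof.
intros H; apply ccont_eps; intros eps He.
destruct (cdiff_continuous f (x, y) eps H He) as [d [Hd Hf]].
exists d; split; [assumption|]; intros u Hu; apply Hf.
eapply Rle_lt_trans; [apply Cmod_le_abs|]; simpl.
replace (x + - x) with 0 by ring; rewrite Rabs_R0; unfold Rminus in Hu; lra.
Qed.

(** The integral over the boundary of [[a, b] x [c, d]], counterclockwise: bottom minus top, plus
    [Ci] times right minus left. *)
Definition rect_int (f : C -> C) (a b c d : R) : C :=
  (Cint (fun s => f (s, c)) a b - Cint (fun s => f (s, d)) a b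
   + Ci * (Cint (fun t => f (b, t)) c d - Cint (fun t => f (a, t)) c d))%C.

Definition cdiff_rect (f : C -> C) (a b c d : R) : Prop :=
  forall x y, a <= x <= b -> c <= y <= d -> cdiff f (x, y).

(** Every inner edge is traversed twice, in opposite directions. *)
Lemma rect_int_bisect f a m b c n d : a <= m <= b -> c <= n <= d -> cdiff_rect f a b c d ->
  rect_int f a b c d =
  (rect_int f a m c n + rect_int f m b c n + rect_int f a m n d + rect_int f m b n d)%C.
Proof.
intros Hm Hn Hf; unfold rect_int.
assert (H : forall y, c <= y <= d ->
  Cint (fun s => f (s, y)) a b = (Cint (fun s => f (s, y)) a m + Cint (fun s => f (s, y)) m b)%C).
{ intros y Hy; rewrite (Cint_Chasles _ a m b); [reflexivity|lra|].
  intros x Hx; apply ccont_horizontal, Hf; lra. }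
assert (V : forall x, a <= x <= b ->
  Cint (fun t => f (x, t)) c d = (Cint (fun t => f (x, t)) c n + Cint (fun t => f (x, t)) n d)%C).
{ intros x Hx; rewrite (Cint_Chasles _ c n d); [reflexivity|lra|].
  intros y Hy; apply ccont_vertical, Hf; lra. }
rewrite (H c), (H d), (V a), (V b) by lra; ring.
Qed.

Lemma Cint_hor_id y a b : Cint (fun s => (s, y)) a b = ((b ^ 2 - a ^ 2) / 2, y * (b - a)).
Proof.
unfold Cint; simpl; f_equal.
- apply is_RInt_unique, is_RInt_id.
- rewrite RInt_const; unfold scal; simpl; unfold mult; simpl; ring.
Qed.

Lemma Cint_ver_id x c d : Cint (fun t => (x, t)) c d = (x * (d - c), (d ^ 2 - c ^ 2) / 2).
Proof.
unfold Cint; simpl; f_equal.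
- rewrite RInt_const; unfold scal; simpl; unfold mult; simpl; ring.
- apply is_RInt_unique, is_RInt_id.
Qed.

Lemma Cint_affine A B g a b : a <= b -> ccont_on g a b ->
  Cint (fun s => (A + B * g s)%C) a b = (A * RtoC (b - a) + B * Cint g a b)%C.
Proof.
intros Hab Hg.
rewrite Cint_plus, Cint_scal; try assumption.
- f_equal; apply injective_projections; simpl;
    rewrite RInt_const; unfold scal; simpl; unfold mult; simpl; ring.
- intros t _; apply ccont_const.
- intros t Ht; apply ccont_mult; [apply ccont_const|now apply Hg].
Qed.

Lemma rect_int_affine A B a b c d : a <= b -> c <= d ->
  rect_int (fun z => (A + B * z)%C) a b c d = RtoC 0.
Proof.
intros Hab Hcd; unfold rect_int.
assert (Hh : forall y, ccont_on (fun s => (s, y)) a b)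
  by (intros y t _; split; [apply continuous_id|apply continuous_const]).
assert (Hv : forall x, ccont_on (fun t => (x, t)) c d)
  by (intros x t _; split; [apply continuous_const|apply continuous_id]).
rewrite !Cint_affine by auto.
rewrite !Cint_hor_id, !Cint_ver_id.
destruct A as [A1 A2], B as [B1 B2].
apply injective_projections; simpl; field.
Qed.

Lemma rect_int_minus f g a b c d : a <= b -> c <= d ->
  cdiff_rect f a b c d -> cdiff_rect g a b c d ->
  rect_int (fun z => (f z - g z)%C) a b c d = (rect_int f a b c d - rect_int g a b c d)%C.
Proof.
intros Hab Hcd Hf Hg; unfold rect_int.
rewrite !Cint_minus; try assumption; try ring;
  intros t Ht; first [apply ccont_horizontal | apply ccont_vertical];
  first [apply Hf | apply Hg]; lra.
Qed.

Lemma cdiff_affine A B z : cdiff (fun z => (A + B * z)%C) z.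
Proof.
exists B; intros eps He; exists 1; split; [lra|]; intros w _.
replace (A + B * w - (A + B * z) - B * (w - z))%C with (RtoC 0) by ring.
rewrite Cmod_0; pose proof (Cmod_ge_0 (w - z)); nra.
Qed.

Lemma Cmod_rect_int_le f g M a b c d : a <= b -> c <= d ->
  cdiff_rect f a b c d -> cdiff_rect g a b c d ->
  (forall x y, a <= x <= b -> c <= y <= d -> Cmod (f (x, y) - g (x, y)) <= M) ->
  Cmod (rect_int f a b c d - rect_int g a b c d) <= 4 * (M * (b - a + (d - c))).
Proof.
intros Hab Hcd Hf Hg HM; rewrite <- rect_int_minus by assumption; unfold rect_int.
assert (Hh : forall y, c <= y <= d ->
  Cmod (Cint (fun s => (f (s, y) - g (s, y))%C) a b) <= 2 * (M * (b - a))).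
{ intros y Hy; apply Cmod_Cint_le_const; [assumption| |intros; now apply HM].
  intros t Ht; apply ccont_minus; apply ccont_horizontal; [apply Hf|apply Hg]; lra. }
assert (Hv : forall x, a <= x <= b ->
  Cmod (Cint (fun t => (f (x, t) - g (x, t))%C) c d) <= 2 * (M * (d - c))).
{ intros x Hx; apply Cmod_Cint_le_const; [assumption| |intros; now apply HM].
  intros t Ht; apply ccont_minus; apply ccont_vertical; [apply Hf|apply Hg]; lra. }
pose proof (Hh c ltac:(lra)); pose proof (Hh d ltac:(lra)).
pose proof (Hv a ltac:(lra)); pose proof (Hv b ltac:(lra)).
eapply Rle_trans; [apply Cmod_triangle|]; rewrite Cmod_mult, Cmod_Ci.
eapply Rle_trans; [apply Rplus_le_compat; [apply Cmod_minus_le|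
  apply Rmult_le_compat_l; [lra|apply Cmod_minus_le]]|].
lra.
Qed.

Lemma nested_intervals (x w : nat -> R) :
  (forall k, x k <= x (S k)) -> (forall k, x (S k) + w (S k) <= x k + w k) ->
  (forall k, 0 <= w k) -> exists X, forall k, x k <= X <= x k + w k.
Proof.
intros Hx Hw H0.
assert (Hmono : forall j k, x k <= x (j + k)%nat).
{ induction j as [|j IH]; intros k; simpl; [lra|].
  eapply Rle_trans; [apply IH|apply Hx]. }
assert (Hanti : forall j k, x (j + k)%nat + w (j + k)%nat <= x k + w k).
{ induction j as [|j IH]; intros k; simpl; [lra|].
  eapply Rle_trans; [apply Hw|apply IH]. }
assert (Hup : forall i k, x i <= x k + w k).
{ intros i k; apply Rle_trans with (x (k + i)%nat); [apply Hmono|].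
  pose proof (Hanti i k); pose proof (H0 (i + k)%nat).
  rewrite Nat.add_comm; lra. }
destruct (completeness (fun r => exists k, r = x k)) as [X [HX1 HX2]].
- exists (x 0%nat + w 0%nat); intros r [k ->]; apply Hup.
- now exists (x 0%nat), 0%nat.
- exists X; intros k; split.
  + apply HX1; now exists k.
  + apply HX2; intros r [i ->]; apply Hup.
Qed.

Section Goursat.

Variables (f : C -> C) (a b c d : R).
Hypotheses (Hab : a <= b) (Hcd : c <= d) (Hf : cdiff_rect f a b c d).

Let width (k : nat) : R := (b - a) * (/ 2) ^ k.
Let height (k : nat) : R := (d - c) * (/ 2) ^ k.

(** [p] is the lower left corner of a cell of generation [k] that still carries a share of at least
    [4^-k] of the modulus of the whole integral. *)
Definition good_cell (k : nat) (p : R * R) : Prop :=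
  (a <= fst p /\ fst p + width k <= b) /\ (c <= snd p /\ snd p + height k <= d) /\
  Cmod (rect_int f a b c d) * (/ 4) ^ k <=
    Cmod (rect_int f (fst p) (fst p + width k) (snd p) (snd p + height k)).

Definition subcell (k : nat) (p q : R * R) : Prop :=
  (fst p <= fst q /\ fst q + width (S k) <= fst p + width k) /\
  (snd p <= snd q /\ snd q + height (S k) <= snd p + height k).

Lemma width_S k : width k = 2 * width (S k) /\ 0 <= width k.
Proof.
unfold width; simpl; split; [field|].
apply Rmult_le_pos; [lra|apply pow_le; lra].
Qed.

Lemma height_S k : height k = 2 * height (S k) /\ 0 <= height k.
Proof.
unfold height; simpl; split; [field|].
apply Rmult_le_pos; [lra|apply pow_le; lra].
Qed.

Lemma good_cell_step k p : good_cell k p -> exists q, good_cell (S k) q /\ subcell k p q.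
Proof.
destruct p as [x y]; unfold good_cell, subcell; simpl fst; simpl snd.
intros [[Hx1 Hx2] [[Hy1 Hy2] Hbig]].
destruct (width_S k) as [HW HW0], (height_S k) as [HH HH0].
set (w := width (S k)) in *; set (h := height (S k)) in *.
set (e := Cmod (rect_int f a b c d)) in *.
replace (x + width k) with (x + w + w) in * by lra.
replace (y + height k) with (y + h + h) in * by lra.
rewrite (rect_int_bisect f x (x + w) (x + w + w) y (y + h) (y + h + h)) in Hbig.
2, 3: lra.
2:{ intros u v Hu Hv; apply Hf; lra. }
set (A1 := rect_int f x (x + w) y (y + h)) in *.
set (A2 := rect_int f (x + w) (x + w + w) y (y + h)) in *.
set (A3 := rect_int f x (x + w) (y + h) (y + h + h)) in *.
set (A4 := rect_int f (x + w) (x + w + w) (y + h) (y + h + h)) in *.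
assert (Hsum : e * (/ 4) ^ k <= Cmod A1 + Cmod A2 + Cmod A3 + Cmod A4).
{ eapply Rle_trans; [exact Hbig|].
  eapply Rle_trans; [apply Cmod_triangle|]; apply Rplus_le_compat_r.
  eapply Rle_trans; [apply Cmod_triangle|]; apply Rplus_le_compat_r.
  apply Cmod_triangle. }
assert (Hq : e * (/ 4) ^ S k = e * (/ 4) ^ k / 4) by (simpl; field).
rewrite Hq.
destruct (Rle_dec (e * (/ 4) ^ k / 4) (Cmod A1)) as [H1|H1];
  [exists (x, y); simpl; fold A1; repeat split; lra|].
destruct (Rle_dec (e * (/ 4) ^ k / 4) (Cmod A2)) as [H2|H2];
  [exists (x + w, y); simpl; fold A2; repeat split; lra|].
destruct (Rle_dec (e * (/ 4) ^ k / 4) (Cmod A3)) as [H3|H3];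
  [exists (x, y + h); simpl; fold A3; repeat split; lra|].
exists (x + w, y + h); simpl; fold A4; repeat split; lra.
Qed.

Fixpoint cell (k : nat) : R * R :=
  match k with
  | O => (a, c)
  | S k => epsilon (inhabits (0, 0)) (fun q => good_cell (S k) q /\ subcell k (cell k) q)
  end.

Lemma cell_spec k : good_cell k (cell k) /\ subcell k (cell k) (cell (S k)).
Proof.
assert (Hstep : forall k, good_cell k (cell k) ->
  good_cell (S k) (cell (S k)) /\ subcell k (cell k) (cell (S k))).
{ intros j Hj; simpl.
  apply (epsilon_spec (inhabits (0, 0))
    (fun q => good_cell (S j) q /\ subcell j (cell j) q)).
  now apply good_cell_step. }
assert (Hgood : good_cell k (cell k)).
{ induction k as [|k IH]; [|now apply Hstep].
  unfold good_cell, width, height; simpl; rewrite !Rmult_1_r.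
  replace (a + (b - a)) with b by ring; replace (c + (d - c)) with d by ring; repeat split; lra. }
split; [assumption|now apply Hstep].
Qed.

Theorem goursat_rectangle : rect_int f a b c d = RtoC 0.
Proof.
destruct (nested_intervals (fun k => fst (cell k)) width) as [X HX].
1, 2: intros k; destruct (cell_spec k) as [_ [? _]]; cbv beta; lra.
1: intros k; apply width_S.
destruct (nested_intervals (fun k => snd (cell k)) height) as [Y HY].
1, 2: intros k; destruct (cell_spec k) as [_ [_ ?]]; cbv beta; lra.
1: intros k; apply height_S.
assert (HXY : cdiff f (X, Y)).
{ apply Hf; [pose proof (HX 0%nat) as H|pose proof (HY 0%nat) as H];
    unfold width, height in H; simpl in H; lra. }
set (e := Cmod (rect_int f a b c d)).
assert (He0 : 0 <= e) by apply Cmod_ge_0.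
destruct (Rle_lt_or_eq_dec 0 e He0) as [He|He]; [|now apply Cmod_eq_0].
exfalso.
set (D := b - a + (d - c)).
assert (HD : 0 <= D) by (unfold D; lra).
destruct HXY as [B HB].
(* Subtracting the affine part at [(X, Y)], the integral over cell [k] is at most
   [4 * eta * (D / 2^k)^2], with [eta] the present constant; this is less than [e / 4^k]. The [+ 1]
   covers a rectangle reduced to a point. *)
destruct (HB (e / (8 * (D ^ 2 + 1)))) as [dl [Hdl Hd]].
{ apply Rdiv_lt_0_compat; [assumption|nra]. }
destruct (exists_half_pow_le D (dl / 2) 0 ltac:(lra)) as [k [_ Hk]].
destruct (cell_spec k) as [[[Hx1 Hx2] [[Hy1 Hy2] Hbig]] _].
destruct (width_S k) as [_ HW0], (height_S k) as [_ HH0].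
specialize (HX k); specialize (HY k); simpl in HX, HY.
set (x := fst (cell k)) in *; set (y := snd (cell k)) in *.
assert (HwhD : width k + height k = D * (/ 2) ^ k)
  by (unfold width, height, D; ring).
pose proof (Cmod_rect_int_le f (fun z => ((f (X, Y) - B * (X, Y)) + B * z)%C)
  (e / (8 * (D ^ 2 + 1)) * (D * (/ 2) ^ k))
  x (x + width k) y (y + height k)) as Hle.
rewrite rect_int_affine in Hle by lra.
assert (Hr : forall z : C, (z - 0)%C = z) by (intros z; ring).
rewrite Hr in Hle.
assert (Hfin : Cmod (rect_int f x (x + width k) y (y + height k)) <=
  4 * (e / (8 * (D ^ 2 + 1)) * (D * (/ 2) ^ k) *
    (x + width k - x + (y + height k - y)))).
{ apply Hle; try lra.
  - intros u v Hu Hv; apply Hf; lra.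
  - intros u v _ _; apply cdiff_affine.
  - intros u v Hu Hv.
    assert (Hdist : Cmod ((u, v) - (X, Y)) <= D * (/ 2) ^ k).
    { eapply Rle_trans; [apply Cmod_le_abs|]; simpl; rewrite <- HwhD.
      apply Rplus_le_compat; apply Rabs_le; lra. }
    replace (f (u, v) - (f (X, Y) - B * (X, Y) + B * (u, v)))%C
      with (f (u, v) - f (X, Y) - B * ((u, v) - (X, Y)))%C by ring.
    eapply Rle_trans; [apply Hd; lra|].
    apply Rmult_le_compat_l; [|assumption].
    apply Rlt_le, Rdiv_lt_0_compat; [assumption|nra]. }
replace (x + width k - x + (y + height k - y)) with (width k + height k) in Hfin by ring.
rewrite HwhD in Hfin.
assert (H4 : (/ 4) ^ k = (/ 2) ^ k * (/ 2) ^ k)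
  by (rewrite <- Rpow_mult_distr; f_equal; field).
fold e in Hbig; rewrite H4 in Hbig.
assert (Hp : 0 < (/ 2) ^ k * (/ 2) ^ k)
  by (apply Rmult_lt_0_compat; apply pow_lt; lra).
set (P := (/ 2) ^ k * (/ 2) ^ k) in *.
replace (4 * (e / (8 * (D ^ 2 + 1)) * (D * (/ 2) ^ k) * (D * (/ 2) ^ k)))
  with (e * P * (D ^ 2 / (2 * (D ^ 2 + 1)))) in Hfin by (unfold P; field; nra).
assert (D ^ 2 / (2 * (D ^ 2 + 1)) < 1).
{ apply Rmult_lt_reg_r with (2 * (D ^ 2 + 1)); [nra|].
  unfold Rdiv; rewrite Rmult_assoc, Rinv_l by nra; nra. }
assert (0 < e * P) by now apply Rmult_lt_0_compat.
nra.
Qed.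

End Goursat.

(** * Fourier coefficients on circles *)

Lemma ex_derive_cdiff (f : C -> C) (z : C) :
  @ex_derive C_AbsRing (AbsRing_NormedModule C_AbsRing) f z -> cdiff f z.
Proof.
intros [l [_ H]]; exists l; intros eps He.
destruct (H z (fun P HP => HP) (mkposreal eps He)) as [d Hd].
exists d; split; [apply cond_pos|]; intros w Hw; specialize (Hd w Hw).
rewrite (Cmult_comm l); exact Hd.
Qed.

(** The two module structures give convertible little-o conditions; only the linearity of the
    differential is proved again. *)
Lemma ex_derive_C_NormedModule (f : C -> C) (z : C) :
  @ex_derive C_AbsRing C_NormedModule f z <->
  @ex_derive C_AbsRing (AbsRing_NormedModule C_AbsRing) f z.
Proof.
split; intros [l [_ H]]; exists l; split; solve [apply is_linear_scal_l | exact H].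
Qed.

Lemma cdiff_ex_derive (f : C -> C) (z : C) :
  cdiff f z -> @ex_derive C_AbsRing C_NormedModule f z.
Proof.
intros [B H]; apply ex_derive_C_NormedModule; exists B; split; [apply is_linear_scal_l|].
intros x Hx.
assert (Ez : z = x) by (apply (is_filter_lim_locally_unique (V := AbsRing_NormedModule C_AbsRing)); exact Hx).
subst x; intros [eps He]; destruct (H eps He) as [d [Hd HB]].
exists (mkposreal d Hd); intros w Hw; specialize (HB w Hw).
rewrite (Cmult_comm B) in HB; exact HB.
Qed.

Lemma cdiff_mult f g z : cdiff f z -> cdiff g z -> cdiff (fun w => (f w * g w)%C) z.
Proof.
intros Hf Hg; apply ex_derive_cdiff.
apply cdiff_ex_derive, ex_derive_C_NormedModule in Hf, Hg.
destruct Hf as [l Hl], Hg as [m Hm]; eexists.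
apply (is_derive_mult (K := C_AbsRing) f g); [exact Hl|exact Hm|].
intros x y; apply Cmult_comm.
Qed.

Lemma cdiff_comp f g z : cdiff f (g z) -> cdiff g z -> cdiff (fun w => f (g w)) z.
Proof.
intros Hf Hg; apply ex_derive_cdiff.
apply cdiff_ex_derive, ex_derive_C_NormedModule in Hf, Hg.
destruct Hf as [l Hl], Hg as [m Hm]; eexists.
exact (is_derive_comp (K := C_AbsRing) (V := AbsRing_NormedModule C_AbsRing) f g z l m Hl Hm).
Qed.

Lemma cdiff_ext f g z : (forall w, f w = g w) -> cdiff f z -> cdiff g z.
Proof.
intros H [B HB]; exists B; intros eps He; destruct (HB eps He) as [d [Hd Hw]].
exists d; split; [assumption|]; intros w; rewrite <- !H; apply Hw.
Qed.

(** * The complex exponential *)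

Definition cexp (z : C) : C := (exp (fst z) * cos (snd z), exp (fst z) * sin (snd z)).

Lemma cexp_plus z w : cexp (z + w) = (cexp z * cexp w)%C.
Proof.
unfold cexp; apply injective_projections; simpl;
  rewrite exp_plus, ?cos_plus, ?sin_plus; ring.
Qed.

Lemma cexp_0 : cexp 0 = RtoC 1.
Proof. unfold cexp; simpl; rewrite exp_0, cos_0, sin_0; apply injective_projections; simpl; ring. Qed.

Lemma Cmod_cexp z : Cmod (cexp z) = exp (fst z).
Proof.
unfold Cmod, cexp; simpl.
replace (exp (fst z) * cos (snd z) * (exp (fst z) * cos (snd z) * 1) +
  exp (fst z) * sin (snd z) * (exp (fst z) * sin (snd z) * 1))
  with ((exp (fst z))² * ((sin (snd z))² + (cos (snd z))²)) by (unfold Rsqr; ring).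
rewrite sin2_cos2, Rmult_1_r, sqrt_Rsqr; [reflexivity|left; apply exp_pos].
Qed.

Lemma cexp_pow (n : nat) z : cexp (RtoC (INR n) * z) = (cexp z ^ n)%C.
Proof.
induction n as [|n IH].
- simpl; rewrite Cmult_0_l; apply cexp_0.
- rewrite S_INR, RtoC_plus, Cmult_plus_distr_r, Cmult_1_l, cexp_plus, IH; simpl; ring.
Qed.

Lemma cexp_periodic s t : cexp (s, t + 2 * PI) = cexp (s, t).
Proof.
unfold cexp; simpl; now rewrite cos_plus, sin_plus, cos_2PI, sin_2PI, !Rmult_0_r, !Rmult_1_r, Rminus_0_r, Rplus_0_r.
Qed.

Lemma cexp_0_l t : cexp (0, t) = (cos t, sin t).
Proof. unfold cexp; simpl; now rewrite exp_0, !Rmult_1_l. Qed.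

Lemma diff_quot_0 (f : R -> R) (l eps : R) : derivable_pt_lim f 0 l -> 0 < eps ->
  exists d, 0 < d /\ forall h, Rabs h < d -> Rabs (f h - f 0 - l * h) <= eps * Rabs h.
Proof.
intros Hf He; destruct (Hf eps He) as [d Hd].
exists d; split; [apply cond_pos|]; intros h Hh.
destruct (Req_dec h 0) as [->|Hh0].
- rewrite Rmult_0_r, !Rminus_diag_eq by ring; rewrite Rabs_R0; lra.
- specialize (Hd h Hh0 Hh); rewrite Rplus_0_l in Hd.
  replace (f h - f 0 - l * h) with (((f h - f 0) / h - l) * h) by (field; assumption).
  rewrite Rabs_mult; apply Rmult_le_compat_r; [apply Rabs_pos|lra].
Qed.

Lemma cdiff_cexp_0 : cdiff cexp 0.
Proof.
exists (RtoC 1); intros eps He.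
(* The error terms [T1] to [T5] add up to [7 * e * Cmod w]. Requiring also [Cmod w < e] makes the
   second-order term [x * sin y] fit. *)
set (e := Rmin 1 (eps / 8)).
assert (He1 : 0 < e) by (apply Rmin_glb_lt; lra).
assert (He2 : e <= 1) by apply Rmin_l.
assert (He3 : e <= eps / 8) by apply Rmin_r.
destruct (diff_quot_0 exp 1 e derivable_pt_lim_exp_0 He1) as [d1 [Hd1 H1]].
destruct (diff_quot_0 sin 1 e derivable_pt_lim_sin_0 He1) as [d2 [Hd2 H2]].
assert (Hcos : derivable_pt_lim cos 0 0).
{ pose proof (derivable_pt_lim_cos 0) as H; now rewrite sin_0, Ropp_0 in H. }
destruct (diff_quot_0 cos 0 e Hcos He1) as [d3 [Hd3 H3]].
set (d := Rmin (Rmin d1 d2) (Rmin d3 e)).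
exists d; split; [unfold d; repeat apply Rmin_glb_lt; lra|].
intros w Hw.
assert (Hw' : Cmod w < d) by (replace w with (w - 0)%C by ring; exact Hw); clear Hw.
assert (Hd : d <= d1 /\ d <= d2 /\ d <= d3 /\ d <= e).
{ unfold d, Rmin; repeat destruct Rle_dec; lra. }
replace (cexp w - cexp 0 - 1 * (w - 0))%C with (cexp w - cexp 0 - w)%C by ring.
replace (w - 0)%C with w by ring.
rewrite cexp_0.
pose proof (abs_fst_le w) as Hx; pose proof (abs_snd_le w) as Hy.
set (m := Cmod w) in *; assert (Hm : 0 <= m) by apply Cmod_ge_0.
destruct w as [x y]; simpl in Hx, Hy.
specialize (H1 x ltac:(lra)); specialize (H2 y ltac:(lra)).
specialize (H3 y ltac:(lra)).
rewrite exp_0 in H1; rewrite sin_0 in H2; rewrite cos_0 in H3.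
eapply Rle_trans; [apply Cmod_le_abs|]; unfold cexp; simpl.
replace (exp x * cos y + - (1) + - x)
  with ((exp x - 1 - 1 * x) * cos y + (1 + x) * (cos y - 1 - 0 * y)) by ring.
replace (exp x * sin y + - 0 + - y)
  with ((exp x - 1 - 1 * x) * sin y + x * sin y + (sin y - 0 - 1 * y)) by ring.
assert (Hcb : Rabs (cos y) <= 1) by (apply Rabs_le; pose proof (COS_bound y); lra).
assert (Hsb : Rabs (sin y) <= 1) by (apply Rabs_le; pose proof (SIN_bound y); lra).
assert (Hem1 : e * Rabs x <= e * m) by (apply Rmult_le_compat_l; lra).
assert (Hem2 : e * Rabs y <= e * m) by (apply Rmult_le_compat_l; lra).
assert (T1 : Rabs ((exp x - 1 - 1 * x) * cos y) <= e * m * 1).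
{ rewrite Rabs_mult; apply Rmult_le_compat; try apply Rabs_pos; lra. }
assert (T2 : Rabs ((1 + x) * (cos y - 1 - 0 * y)) <= 2 * (e * m)).
{ rewrite Rabs_mult; apply Rmult_le_compat; try apply Rabs_pos; [|lra].
  eapply Rle_trans; [apply Rabs_triang|]; rewrite Rabs_R1; lra. }
assert (T3 : Rabs ((exp x - 1 - 1 * x) * sin y) <= e * m * 1).
{ rewrite Rabs_mult; apply Rmult_le_compat; try apply Rabs_pos; lra. }
assert (T4 : Rabs (x * sin y) <= e * (2 * m)).
{ rewrite Rabs_mult; apply Rmult_le_compat; try apply Rabs_pos; [lra|].
  replace (sin y) with ((sin y - 0 - 1 * y) + y) by ring.
  eapply Rle_trans; [apply Rabs_triang|]; pose proof (Rabs_pos y); nra. }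
assert (T5 : Rabs (sin y - 0 - 1 * y) <= e * m) by lra.
eapply Rle_trans; [apply Rplus_le_compat; [apply Rabs_triang|]|].
{ eapply Rle_trans; [apply Rabs_triang|]; apply Rplus_le_compat_r, Rabs_triang. }
nra.
Qed.

(** The functional equation [cexp w = cexp z * cexp (w - z)] moves the point to [0]. *)
Lemma cdiff_cexp z : cdiff cexp z.
Proof.
apply cdiff_ext with (fun w => (cexp z * cexp (- z + 1 * w))%C).
{ intros w; rewrite <- cexp_plus; f_equal; ring. }
apply cdiff_mult.
- apply cdiff_ext with (fun w => (cexp z + 0 * w)%C); [intros; ring|apply cdiff_affine].
- apply (cdiff_comp cexp (fun w => (- z + 1 * w)%C)); [|apply cdiff_affine].
  replace (- z + 1 * z)%C with (RtoC 0) by ring; apply cdiff_cexp_0.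
Qed.

Lemma cdiff_cexp_scal c z : cdiff (fun w => cexp (c * w)) z.
Proof.
apply cdiff_ext with (fun w => cexp (0 + c * w)); [intros; f_equal; ring|].
apply (cdiff_comp cexp (fun w => (0 + c * w)%C)); [apply cdiff_cexp|apply cdiff_affine].
Qed.

Lemma cos_sin_2_IZR_PI (k : Z) : cos (2 * IZR k * PI) = 1 /\ sin (2 * IZR k * PI) = 0.
Proof.
assert (H : forall n, cos (2 * INR n * PI) = 1 /\ sin (2 * INR n * PI) = 0).
{ intros n; pose proof (cos_period 0 n) as Hc; pose proof (sin_period 0 n) as Hs.
  now rewrite Rplus_0_l, ?cos_0, ?sin_0 in *. }
destruct (Z_le_dec 0 k) as [Hk|Hk].
- rewrite <- (Z2Nat.id k Hk), <- INR_IZR_INZ; apply H.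
- replace k with (- Z.of_nat (Z.to_nat (- k)))%Z by lia.
  rewrite opp_IZR, <- INR_IZR_INZ.
  destruct (H (Z.to_nat (- k))) as [Hc Hs].
  rewrite Ropp_mult_distr_r_reverse, Ropp_mult_distr_l_reverse,
    cos_neg, sin_neg, Hc, Hs.
  lra.
Qed.

(** * Fourier coefficients in logarithmic coordinates *)

Section Fourier.

Variables (F : C -> C) (M : R).
Hypothesis HF : forall z, Cmod z < 1 -> cdiff F z.
Hypothesis HM : forall z, Cmod z < 1 -> Cmod (F z) <= M.

(** [cexp] maps the left half-plane onto the punctured disc and vertical segments of length [2 * PI]
    onto circles, so comparing two radii becomes an integral over the boundary of a rectangle. *)
Definition twisted (n : Z) (w : C) : C := (F (cexp w) * cexp (RtoC (- IZR n) * w))%C.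

(** The [n]-th Laurent coefficient times [2 * PI]; the factor [exp (- n s)] is already in [twisted],
    so no dependence on the radius is expected. *)
Definition fourier (n : Z) (s : R) : C := Cint (fun t => twisted n (s, t)) 0 (2 * PI).

Lemma cexp_lt_1 s t : s < 0 -> Cmod (cexp (s, t)) < 1.
Proof.
intros Hs; rewrite Cmod_cexp; simpl; rewrite <- exp_0; now apply exp_increasing.
Qed.

Lemma cdiff_twisted n s t : s < 0 -> cdiff (twisted n) (s, t).
Proof.
intros Hs; apply cdiff_mult; [|apply cdiff_cexp_scal].
apply (cdiff_comp F cexp); [apply HF; now apply cexp_lt_1|apply cdiff_cexp].
Qed.

Lemma twisted_periodic n s : twisted n (s, 2 * PI) = twisted n (s, 0).
Proof.
unfold twisted.
assert (H1 : cexp (s, 2 * PI) = cexp (s, 0))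
  by (rewrite <- (cexp_periodic s 0); do 2 f_equal; ring).
assert (H2 : cexp (RtoC (- IZR n) * (s, 2 * PI)) = cexp (RtoC (- IZR n) * (s, 0))).
{ unfold Cmult, RtoC, cexp; simpl.
  rewrite !Rmult_0_l, !Rmult_0_r, !Rminus_0_r, !Rplus_0_r.
  replace (- IZR n * (2 * PI)) with (2 * IZR (- n) * PI) by (rewrite opp_IZR; ring).
  now destruct (cos_sin_2_IZR_PI (- n)) as [-> ->]; rewrite cos_0, sin_0. }
now rewrite H1, H2.
Qed.

Lemma two_PI_pos : 0 <= 2 * PI.
Proof. pose proof PI_RGT_0; lra. Qed.

(** In Goursat's theorem on [[s1, s2] x [0, 2 PI]] the horizontal sides cancel by periodicity; the
    vertical ones are the two coefficients. *)
Lemma fourier_le_const n s1 s2 : s1 <= s2 -> s2 < 0 -> fourier n s1 = fourier n s2.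
Proof.
intros H12 H2.
pose proof (goursat_rectangle (twisted n) s1 s2 0 (2 * PI) H12 two_PI_pos) as H.
unfold rect_int in H; fold (fourier n s1) (fourier n s2) in H.
rewrite (Cint_ext (fun s => twisted n (s, 2 * PI)) (fun s => twisted n (s, 0))) in H
  by (try assumption; intros; apply twisted_periodic).
assert (HC : (Ci * (fourier n s2 - fourier n s1))%C = RtoC 0).
{ rewrite <- H; [ring|]; intros x y Hx _; apply cdiff_twisted; lra. }
apply (f_equal (Cmult (- Ci))) in HC.
assert (Hi : (- Ci * Ci)%C = RtoC 1) by (apply injective_projections; simpl; ring).
rewrite Cmult_assoc, Hi in HC.
replace (fourier n s2) with (fourier n s1 + 1 * (fourier n s2 - fourier n s1))%C by ring.
rewrite HC; ring.
Qed.

Lemma fourier_const n s1 s2 : s1 < 0 -> s2 < 0 -> fourier n s1 = fourier n s2.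
Proof.
intros H1 H2; destruct (Rle_dec s1 s2).
- now apply fourier_le_const.
- symmetry; apply fourier_le_const; lra.
Qed.

(* [n < 0]: the coefficient does not depend on [s] but is [O(e^s)] as [s -> -oo]. *)
Lemma fourier_neg n s : (n < 0)%Z -> s < 0 -> fourier n s = RtoC 0.
Proof.
intros Hn Hs; apply Cmod_eq_0.
assert (HM0 : 0 <= M).
{ eapply Rle_trans; [apply Cmod_ge_0|apply (HM 0)]; rewrite Cmod_0; lra. }
pose proof PI_RGT_0 as Hpi.
assert (Hb : forall u, u < 0 -> Cmod (fourier n s) <= 2 * (M * exp u * (2 * PI - 0))).
{ intros u Hu; rewrite (fourier_const n s u) by assumption.
  apply Cmod_Cint_le_const; [apply two_PI_pos| |].
  - intros t _; now apply ccont_vertical, cdiff_twisted.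
  - intros t _; unfold twisted; rewrite Cmod_mult, Cmod_cexp; simpl.
    rewrite Rmult_0_l, Rminus_0_r, <- opp_IZR.
    apply Rmult_le_compat; [apply Cmod_ge_0|left; apply exp_pos| |].
    + now apply HM, cexp_lt_1.
    + assert (Hn1 : 1 <= IZR (- n)) by (apply IZR_le; lia).
      destruct (Rle_lt_or_eq_dec (IZR (- n) * u) u ltac:(nra)) as [H|H];
        [left; now apply exp_increasing|rewrite H; lra]. }
apply Rle_antisym; [|apply Cmod_ge_0].
apply Rnot_lt_le; intros Hpos.
set (e := Cmod (fourier n s)) in *.
(* With [u = ln v] the bound reads [e <= 4 * PI * M * v], which this [v] contradicts; the cap [/ 2]
   makes [ln v] negative, and [M + 1] allows [M = 0]. *)
set (v := Rmin (/ 2) (e / (8 * (M + 1) * PI))).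
assert (Hv : 0 < v).
{ apply Rmin_glb_lt; [lra|]; apply Rdiv_lt_0_compat; [assumption|nra]. }
assert (Hv1 : v <= / 2) by apply Rmin_l.
assert (Hv2 : v <= e / (8 * (M + 1) * PI)) by apply Rmin_r.
specialize (Hb (ln v)); rewrite exp_ln in Hb by assumption.
assert (Hln : ln v < 0) by (rewrite <- ln_1; apply ln_increasing; lra).
specialize (Hb Hln).
apply Rmult_le_compat_l with (r := 8 * (M + 1) * PI) in Hv2; [|nra].
replace (8 * (M + 1) * PI * (e / (8 * (M + 1) * PI))) with e in Hv2 by (field; split; lra).
assert (0 < PI * v) by (apply Rmult_lt_0_compat; assumption).
nra.
Qed.

Lemma ccont_F_circle s t : s < 0 -> ccont (fun t => F (cexp (s, t))) t.
Proof.
intros Hs; apply (ccont_vertical (fun w => F (cexp w))).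
apply (cdiff_comp F cexp); [apply HF; now apply cexp_lt_1|apply cdiff_cexp].
Qed.

Lemma ccont_cexp_circle th t : ccont (fun t => cexp (0, (th - t)%R)) t.
Proof.
split; simpl; apply (ex_derive_continuous (V := R_NormedModule)); auto_derive; easy.
Qed.

Lemma ccont_cexp_scal_circle (r : R) th t : ccont (fun t => cexp (r * (0, (th - t)%R))) t.
Proof.
split; simpl; apply (ex_derive_continuous (V := R_NormedModule)); auto_derive; easy.
Qed.

(** Writing [i n (th - t)] as [n (s + i th) - n (s + i t)] turns the convolution into
    [z^n * fourier n s] with [z = cexp (s, th)]. One [P] serves all radii because the coefficient
    can be evaluated at [s = -1]. *)
Lemma convolution_monomial (n : Z) : exists P : list C, forall s th : R, s < 0 ->
  Cint (fun t => (F (cexp (s, t)) * cexp (RtoC (IZR n) * (0, (th - t)%R)))%C) 0 (2 * PI)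
  = peval P (cexp (s, th)).
Proof.
assert (H : forall s th : R, s < 0 ->
  Cint (fun t => (F (cexp (s, t)) * cexp (RtoC (IZR n) * (0, (th - t)%R)))%C) 0 (2 * PI)
  = (cexp (RtoC (IZR n) * (s, th)) * fourier n s)%C).
{ intros s th Hs; unfold fourier.
  rewrite <- Cint_scal; [|apply two_PI_pos|intros t _; now apply ccont_vertical, cdiff_twisted].
  apply Cint_ext; [apply two_PI_pos|]; intros t _; unfold twisted.
  replace (RtoC (IZR n) * (0, (th - t)%R))%C
    with (RtoC (IZR n) * (s, th) + RtoC (- IZR n) * (s, t))%C
    by (apply injective_projections; simpl; ring).
  rewrite cexp_plus; ring. }
destruct (Z_lt_le_dec n 0) as [Hn|Hn].
- exists nil; intros s th Hs; rewrite H, fourier_neg by assumption; simpl; ring.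
- exists (pzero (Z.to_nat n) ++ [fourier n (-1)]); intros s th Hs.
  rewrite H, peval_shift, (fourier_const n s (-1)) by lra.
  rewrite <- cexp_pow, INR_IZR_INZ, Z2Nat.id by assumption; simpl; ring.
Qed.

(** A trigonometric polynomial is given as [e^(i n u) l (e^(i u))] with [n] of any sign; the
    induction splits off one character and raises [n] by one. *)
Lemma convolution_trig_poly (l : list C) (n : Z) : exists P : list C, forall s th : R, s < 0 ->
  Cint (fun t => (F (cexp (s, t)) *
          (cexp (RtoC (IZR n) * (0, (th - t)%R)) * peval l (cexp (0, (th - t)%R))))%C) 0 (2 * PI)
  = peval P (cexp (s, th)).
Proof.
revert n; induction l as [|x l IH]; intros n.
- exists nil; intros s th Hs; simpl.
  rewrite (Cint_ext _ (fun t => (0 * F (cexp (s, t)))%C));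
    [|apply two_PI_pos|intros; ring].
  rewrite Cint_scal; [ring|apply two_PI_pos|intros t _; now apply ccont_F_circle].
- destruct (convolution_monomial n) as [P0 HP0], (IH (n + 1)%Z) as [P1 HP1].
  exists (padd (pscal x P0) P1); intros s th Hs.
  rewrite peval_padd, peval_pscal, <- HP0, <- HP1 by assumption.
  assert (Hc : forall k, ccont_on
    (fun t => (F (cexp (s, t)) * cexp (RtoC (IZR k) * (0, (th - t)%R)))%C) 0 (2 * PI)).
  { intros k t _; apply ccont_mult; [now apply ccont_F_circle|apply ccont_cexp_scal_circle]. }
  rewrite <- Cint_scal; [|apply two_PI_pos|apply Hc].
  rewrite <- Cint_plus; [|apply two_PI_pos| |].
  + apply Cint_ext; [apply two_PI_pos|]; intros t _; simpl peval.
    replace (RtoC (IZR (n + 1)) * (0, (th - t)%R))%C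
      with (RtoC (IZR n) * (0, (th - t)%R) + (0, (th - t)%R))%C
      by (rewrite plus_IZR; apply injective_projections; simpl; ring).
    rewrite cexp_plus; ring.
  + intros t Ht; apply ccont_mult; [apply ccont_const|now apply Hc].
  + intros t _; apply ccont_mult; [now apply ccont_F_circle|].
    apply ccont_mult; [apply ccont_cexp_scal_circle|].
    apply ccont_peval, ccont_cexp_circle.
Qed.

(** The de la Vallee-Poussin kernel [cos (u / 2)^(2 N)], not normalised: nonnegative, a
    trigonometric polynomial, concentrated at [u = 0] modulo [2 * PI]. *)
Definition kern (N : nat) (u : R) : R := ((1 + cos u) / 2) ^ N.

Lemma kern_trig_poly (N : nat) : exists l : list C, forall u,
  RtoC (kern N u) = (cexp (RtoC (IZR (- Z.of_nat N)) * (0, u)) * peval l (cexp (0, u)))%C.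
Proof.
induction N as [|N [l IH]].
- exists [RtoC 1]; intros u; unfold kern; simpl.
  rewrite Cmult_0_l, cexp_0; ring.
(* [(1 + cos u) / 2 = e^(- i u) (1/4 + e^(i u) / 2 + e^(2 i u) / 4)]. *)
- exists (pmul [RtoC (/ 4); RtoC (/ 2); RtoC (/ 4)] l); intros u.
  change (kern (S N) u) with ((1 + cos u) / 2 * kern N u).
  rewrite RtoC_mult, IH, peval_pmul, Nat2Z.inj_succ.
  replace (RtoC (IZR (- Z.succ (Z.of_nat N))) * (0, u))%C
    with (RtoC (IZR (- Z.of_nat N)) * (0, u) + (0, (- u)%R))%C.
  2:{ rewrite !opp_IZR, succ_IZR; apply injective_projections; simpl; ring. }
  rewrite cexp_plus.
  assert (Hk : RtoC ((1 + cos u) / 2) =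
    (cexp (0, (- u)%R) * peval [RtoC (/ 4); RtoC (/ 2); RtoC (/ 4)] (cexp (0, u)))%C).
  { rewrite !cexp_0_l, cos_neg, sin_neg.
    pose proof (sin2_cos2 u) as H; unfold Rsqr in H.
    apply injective_projections; simpl; apply Rminus_diag_uniq.
    - transitivity ((1 - (sin u * sin u + cos u * cos u)) * (/ 2 + cos u / 4));
        [field|rewrite H; ring].
    - transitivity ((1 - (sin u * sin u + cos u * cos u)) * (sin u / 4));
        [field|rewrite H; ring]. }
  rewrite Hk; ring.
Qed.

Lemma convolution_kern (N : nat) : exists P : list C, forall s th : R, s < 0 ->
  Cint (fun t => (F (cexp (s, t)) * RtoC (kern N (th - t)))%C) 0 (2 * PI)
  = peval P (cexp (s, th)).
Proof.
destruct (kern_trig_poly N) as [l Hl].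
destruct (convolution_trig_poly l (- Z.of_nat N)) as [P HP].
exists P; intros s th Hs; rewrite <- HP by assumption.
apply Cint_ext; [apply two_PI_pos|]; intros t _; now rewrite Hl.
Qed.

End Fourier.

(** * Integrals of the kernel and the Korovkin estimate *)

Lemma kern_ge0 N u : 0 <= kern N u.
Proof. apply pow_le; pose proof (COS_bound u); lra. Qed.

Lemma continuous_kern N th t : continuous (fun t => kern N (th - t)) t.
Proof.
apply (ex_derive_continuous (V := R_NormedModule)); unfold kern; auto_derive; easy.
Qed.

Lemma continuous_cos_kern N th t : continuous (fun t => (1 - cos (th - t)) * kern N (th - t)) t.
Proof.
apply (ex_derive_continuous (V := R_NormedModule)); unfold kern; auto_derive; easy.
Qed.

Lemma ex_RInt_kern N th : ex_RInt (fun t => kern N (th - t)) 0 (2 * PI).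
Proof. apply ex_RInt_cont; [apply two_PI_pos|intros; apply continuous_kern]. Qed.

Lemma ex_RInt_cos_kern N th : ex_RInt (fun t => (1 - cos (th - t)) * kern N (th - t)) 0 (2 * PI).
Proof. apply ex_RInt_cont; [apply two_PI_pos|intros; apply continuous_cos_kern]. Qed.

(* Integrate the derivative of the periodic function [sin u * kern N u]. *)
Lemma RInt_cos_kern N th :
  INR (S N) * RInt (fun t => (1 - cos (th - t)) * kern N (th - t)) 0 (2 * PI)
  = RInt (fun t => kern N (th - t)) 0 (2 * PI).
Proof.
set (J := fun t => (1 - cos (th - t)) * kern N (th - t)).
set (K := fun t => kern N (th - t)).
assert (HI : is_RInt (fun t => INR (S N) * J t - K t) 0 (2 * PI)
  (minus (sin (th - 2 * PI) * kern N (th - 2 * PI)) (sin (th - 0) * kern N (th - 0)))).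
{ apply (is_RInt_derive (fun t => sin (th - t) * kern N (th - t))).
  - intros t _; unfold J, K, kern; auto_derive; [easy|].
    change (th + - t) with (th - t).
    pose proof (sin2_cos2 (th - t)) as H; unfold Rsqr in H.
    set (c := cos (th - t)) in *; set (s := sin (th - t)) in *.
    destruct N as [|N]; [simpl; ring|].
    rewrite (S_INR (S N)); change (Init.Nat.pred (S N)) with N.
    set (n := INR (S N)).
    rewrite <- !tech_pow_Rmult; change ((1 + c) * / 2) with ((1 + c) / 2).
    set (Y := ((1 + c) / 2) ^ N).
    (* Differentiation lowers the exponent; [sin^2 = (1 - cos) (1 + cos)] restores the missing
       factor. *)
    replace (s * (- (1) * - s * / 2 * (n * Y))) with (s * s * (/ 2 * (n * Y))) by ring.
    replace (s * s) with (1 - c * c) by lra; field.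
  - intros t _; apply (continuous_minus (V := R_NormedModule)); [|apply continuous_kern].
    apply (continuous_scal_r (V := R_NormedModule)), continuous_cos_kern. }
replace (th - 2 * PI) with (th - 0 - 2 * PI) in HI by ring.
assert (Hp : minus (sin (th - 0 - 2 * PI) * kern N (th - 0 - 2 * PI))
                   (sin (th - 0) * kern N (th - 0)) = 0).
{ unfold kern; rewrite (sin_minus (th - 0)), (cos_minus (th - 0)), sin_2PI, cos_2PI.
  rewrite !Rmult_0_r, !Rmult_1_r, Rminus_0_r, Rplus_0_r.
  apply (minus_eq_zero (G := R_AbelianGroup)). }
rewrite Hp in HI; apply (is_RInt_unique (V := R_CompleteNormedModule)) in HI.
rewrite (RInt_minus (V := R_CompleteNormedModule) (fun t => INR (S N) * J t) K) in HI;
  [|apply (ex_RInt_scal (V := R_NormedModule)); apply ex_RInt_cos_kern|apply ex_RInt_kern].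
rewrite (RInt_scal (V := R_CompleteNormedModule) J) in HI by apply ex_RInt_cos_kern.
unfold minus, plus, opp, scal in HI; simpl in HI; unfold mult in HI; simpl in HI.
simpl (INR (S N)); lra.
Qed.

(** The Wallis integral [2 PI binom (2 N, N) / 4^N], in the recursive form that follows from [kern
    (S N) = kern N - (1 - cos) / 2 * kern N] and [RInt_cos_kern]. *)
Fixpoint kern_mass (N : nat) : R :=
  match N with O => 2 * PI | S N => kern_mass N * (1 - / (2 * INR (S N))) end.

Lemma kern_mass_pos N : 0 < kern_mass N.
Proof.
induction N as [|N IH]; [simpl; pose proof PI_RGT_0; lra|].
cbn [kern_mass]; apply Rmult_lt_0_compat; [assumption|].
assert (HN : 1 <= INR (S N)) by (rewrite S_INR; pose proof (pos_INR N); lra).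
assert (/ (2 * INR (S N)) <= / 2) by (apply Rinv_le_contravar; lra).
lra.
Qed.

Lemma RInt_kern N th : RInt (fun t => kern N (th - t)) 0 (2 * PI) = kern_mass N.
Proof.
induction N as [|N IH].
- unfold kern; simpl; rewrite RInt_const; unfold scal; simpl; unfold mult; simpl; ring.
- cbn [kern_mass]; rewrite <- IH.
  pose proof (RInt_cos_kern N th) as HJ.
  assert (HN : INR (S N) <> 0) by (apply not_0_INR; lia).
  transitivity (RInt (fun t => kern N (th - t)) 0 (2 * PI)
    - / 2 * RInt (fun t => (1 - cos (th - t)) * kern N (th - t)) 0 (2 * PI)).
  + rewrite <- (RInt_scal (V := R_CompleteNormedModule)) by apply ex_RInt_cos_kern.
    rewrite <- (RInt_minus (V := R_CompleteNormedModule)).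
    * apply RInt_ext; intros t _.
      unfold minus, plus, opp, scal; simpl; unfold mult; simpl.
      unfold kern; simpl.
      match goal with |- ?x = ?y => change (@eq R x y) end; field.
    * apply ex_RInt_kern.
    * apply (ex_RInt_scal (V := R_NormedModule)); apply ex_RInt_cos_kern.
  + rewrite <- HJ.
    match goal with |- ?x = ?y => change (@eq R x y) end; field; assumption.
Qed.

Lemma RInt_kern_comb (a b : R) N th :
  RInt (fun t => a * kern N (th - t) + b * ((1 - cos (th - t)) * kern N (th - t))) 0 (2 * PI)
  = a * RInt (fun t => kern N (th - t)) 0 (2 * PI)
    + b * RInt (fun t => (1 - cos (th - t)) * kern N (th - t)) 0 (2 * PI).
Proof.
apply is_RInt_unique, (is_RInt_plus (V := R_NormedModule));
  apply (is_RInt_scal (V := R_NormedModule)), (RInt_correct (V := R_CompleteNormedModule)).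
- apply ex_RInt_kern.
- apply ex_RInt_cos_kern.
Qed.

Lemma exists_cos_sin (x y : R) : x * x + y * y = 1 -> exists t, cos t = x /\ sin t = y.
Proof.
intros H.
assert (Hx : -1 <= x <= 1) by nra.
assert (Hs : sin (acos x) = Rabs y).
{ rewrite sin_acos by assumption; rewrite <- sqrt_Rsqr_abs; f_equal; unfold Rsqr; lra. }
destruct (Rle_dec 0 y) as [Hy|Hy].
- exists (acos x); rewrite cos_acos, Hs, Rabs_pos_eq by assumption; easy.
- exists (- acos x); rewrite cos_neg, sin_neg, cos_acos, Hs, Rabs_left by lra; split; lra.
Qed.

Lemma cexp_surj (z : C) : z <> RtoC 0 -> exists t : R, z = cexp (ln (Cmod z), t).
Proof.
intros Hz; apply Cmod_gt_0 in Hz.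
destruct (exists_cos_sin (fst z / Cmod z) (snd z / Cmod z)) as [t [Hc Hs]].
{ pose proof (Cmod2_alt z) as H.
  replace (fst z / Cmod z * (fst z / Cmod z) + snd z / Cmod z * (snd z / Cmod z))
    with ((Re z ^ 2 + Im z ^ 2) / (Cmod z ^ 2)) by (unfold Re, Im; field; lra).
  rewrite <- H; field; lra. }
exists t; unfold cexp; simpl; rewrite exp_ln, Hc, Hs by assumption.
apply injective_projections; simpl; field; lra.
Qed.

(* Korovkin's argument: [C |z - w|^2] turns into [2 C (1 - cos)] on circles, whose
   mean against the kernel is [2 C / (N + 1)]. *)
Lemma polynomial_approx_punctured (F : C -> C) (M : R) :
  (forall z, Cmod z < 1 -> cdiff F z) ->
  (forall z, Cmod z < 1 -> Cmod (F z) <= M) ->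
  (forall eps, 0 < eps -> exists B, 0 <= B /\ forall z w, Cmod z < 1 -> Cmod w < 1 ->
     Cmod (F z - F w) <= eps + B * Cmod (z - w) ^ 2) ->
  forall eps, 0 < eps -> exists P : list C, forall z, z <> RtoC 0 -> Cmod z < 1 ->
    Cmod (peval P z - F z) <= eps.
Proof.
intros HF HM Hunif eps He.
destruct (Hunif (eps / 4) ltac:(lra)) as [B [HB0 HB]].
(* The final bound is [2 * (eps / 4 + 2 * B / (N + 1))]; this [N] makes the second part at most
   [eps / 4]. *)
destruct (archimed_cor1 (eps / (16 * (B + 1)))) as [N [HN HN0]].
{ apply Rdiv_lt_0_compat; lra. }
destruct (convolution_kern F M HF HM N) as [P HP].
pose proof (kern_mass_pos N) as Hm.
exists (pscal (RtoC (/ kern_mass N)) P); intros z Hz0 Hz1.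
destruct (cexp_surj z Hz0) as [th Hz].
set (s := ln (Cmod z)) in *.
assert (Hs : s < 0).
{ unfold s; rewrite <- ln_1; apply ln_increasing; [now apply Cmod_gt_0|assumption]. }
rewrite peval_pscal.
rewrite Hz at 1; rewrite <- HP by assumption.
assert (HcK : ccont_on (fun t => RtoC (kern N (th - t))) 0 (2 * PI))
  by (intros t _; apply ccont_RtoC, continuous_kern).
assert (HcF : ccont_on (fun t => (F (cexp (s, t)) * RtoC (kern N (th - t)))%C) 0 (2 * PI)).
{ intros t Ht; apply ccont_mult; [now apply (ccont_F_circle F HF)|now apply HcK]. }
(* [F z] is the kernel mean of a constant, so the error is the mean of [F (cexp (s, t)) - F z]. *)
assert (HFz : F z = (RtoC (/ kern_mass N) *
  Cint (fun t => (F z * RtoC (kern N (th - t)))%C) 0 (2 * PI))%C).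
{ rewrite Cint_scal by (try apply two_PI_pos; assumption).
  unfold Cint; simpl; rewrite RInt_kern, RInt_const.
  unfold scal; simpl; unfold mult; simpl; rewrite Rmult_0_r.
  change ((kern_mass N, 0) : C) with (RtoC (kern_mass N)).
  rewrite (Cmult_comm (F z)), Cmult_assoc, <- RtoC_mult, Rinv_l by lra; ring. }
rewrite HFz at 1.
replace (RtoC (/ kern_mass N) * Cint (fun t => (F (cexp (s, t)) * RtoC (kern N (th - t)))%C) 0 (2 * PI)
  - RtoC (/ kern_mass N) * Cint (fun t => (F z * RtoC (kern N (th - t)))%C) 0 (2 * PI))%C
  with (RtoC (/ kern_mass N) * (Cint (fun t => (F (cexp (s, t)) * RtoC (kern N (th - t)))%C) 0 (2 * PI)
  - Cint (fun t => (F z * RtoC (kern N (th - t)))%C) 0 (2 * PI)))%C by ring.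
rewrite <- Cint_minus; try assumption; try apply two_PI_pos.
2:{ intros t Ht; apply ccont_mult; [apply ccont_const|now apply HcK]. }
rewrite Cmod_mult, Cmod_R, Rabs_pos_eq by (left; apply Rinv_0_lt_compat; lra).
assert (Hint : Cmod (Cint (fun t => (F (cexp (s, t)) * RtoC (kern N (th - t))
      - F z * RtoC (kern N (th - t)))%C) 0 (2 * PI))
  <= 2 * RInt (fun t => eps / 4 * kern N (th - t)
       + 2 * B * ((1 - cos (th - t)) * kern N (th - t))) 0 (2 * PI)).
{ apply Cmod_Cint_le; [apply two_PI_pos| | |].
  - intros t Ht; apply ccont_minus; [now apply HcF|].
    apply ccont_mult; [apply ccont_const|now apply HcK].
  - intros t _; apply (continuous_plus (V := R_NormedModule));
      apply (continuous_scal_r (V := R_NormedModule));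
      [apply continuous_kern|apply continuous_cos_kern].
  - intros t _.
    replace (F (cexp (s, t)) * RtoC (kern N (th - t)) - F z * RtoC (kern N (th - t)))%C
      with ((F (cexp (s, t)) - F z) * RtoC (kern N (th - t)))%C by ring.
    pose proof (kern_ge0 N (th - t)) as Hk.
    rewrite Cmod_mult, Cmod_R, (Rabs_pos_eq (kern _ _)) by assumption.
    replace (eps / 4 * kern N (th - t) + 2 * B * ((1 - cos (th - t)) * kern N (th - t)))
      with ((eps / 4 + B * (2 * (1 - cos (th - t)))) * kern N (th - t)) by ring.
    apply Rmult_le_compat_r; [assumption|].
    eapply Rle_trans; [apply HB; [now apply cexp_lt_1|assumption]|].
    apply Rplus_le_compat_l, Rmult_le_compat_l; [assumption|].
    (* Both points lie on the circle of radius [exp s < 1], where the squared distance is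
       [exp (2 s) * 2 * (1 - cos (th - t))]. *)
    rewrite Hz, Cmod2_alt; unfold cexp, Re, Im; simpl.
    assert (He1 : 0 < exp s < 1)
      by (split; [apply exp_pos|rewrite <- exp_0; now apply exp_increasing]).
    rewrite cos_minus.
    pose proof (sin2_cos2 t) as Ht; pose proof (sin2_cos2 th) as Hth; unfold Rsqr in Ht, Hth.
    pose proof (COS_bound (th - t)) as Hc; rewrite cos_minus in Hc.
    set (c := cos t) in *; set (v := sin t) in *.
    set (c' := cos th) in *; set (v' := sin th) in *.
    replace ((exp s * c + - (exp s * c')) * ((exp s * c + - (exp s * c')) * 1) +
      (exp s * v + - (exp s * v')) * ((exp s * v + - (exp s * v')) * 1))
      with (exp s * exp s * ((v * v + c * c) + (v' * v' + c' * c') - 2 * (c' * c + v' * v)))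
      by ring.
    rewrite Ht, Hth.
    assert (exp s * exp s <= 1) by nra.
    nra. }
rewrite RInt_kern_comb in Hint.
pose proof (RInt_cos_kern N th) as HJ; rewrite RInt_kern in HJ, Hint.
set (J := (RInt (fun t => (1 - cos (th - t)) * kern N (th - t)) 0 (2 * PI)) : R) in *.
assert (HSN : 0 < INR N < INR (S N)) by (rewrite S_INR; split; [apply lt_0_INR; lia|lra]).
assert (HJ' : J = kern_mass N * / INR (S N)) by (rewrite <- HJ; field; lra).
assert (Hinv : / INR (S N) <= eps / (16 * (B + 1))).
{ left; eapply Rlt_trans; [|exact HN]; apply Rinv_lt_contravar; nra. }
assert (HBN : 4 * B * / INR (S N) <= eps / 4).
{ apply Rle_trans with (4 * B * (eps / (16 * (B + 1)))); [apply Rmult_le_compat_l; lra|].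
  replace (4 * B * (eps / (16 * (B + 1)))) with (eps / 4 * (B / (B + 1))) by (field; lra).
  assert (B / (B + 1) <= 1).
  { apply Rmult_le_reg_r with (B + 1); [lra|]; unfold Rdiv; rewrite Rmult_assoc, Rinv_l; lra. }
  nra. }
apply Rmult_le_reg_l with (kern_mass N); [assumption|].
rewrite <- Rmult_assoc, Rinv_r, Rmult_1_l by lra.
eapply Rle_trans; [exact Hint|]; rewrite HJ'.
replace (2 * (eps / 4 * kern_mass N + 2 * B * (kern_mass N * / INR (S N))))
  with (kern_mass N * (eps / 2 + 4 * B * / INR (S N))) by (field; lra).
apply Rmult_le_compat_l; lra.
Qed.

(** * Density of polynomials in the disc algebra *)

Lemma locally_Cmod (z : C) (P : C -> Prop) :
  locally z P <-> exists d, 0 < d /\ forall w, Cmod (w - z) < d -> P w.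
Proof.
split.
- intros H; apply locally_C in H; destruct H as [d Hd].
  exists d; split; [apply cond_pos|exact Hd].
- intros [d [Hd H]]; apply locally_C; exists (mkposreal d Hd); exact H.
Qed.

Lemma closure_open_disc (c : C) (r : R) (z : C) : 0 < r ->
  (closure (open_disc c r) z <-> Cmod (z - c) <= r).
Proof.
intros Hr; unfold closure, open_disc; split.
- intros H; apply Rnot_lt_le; intros Hlt.
  destruct (H (fun w => Cmod (w - z) < Cmod (z - c) - r)) as [w [H1 H2]].
  { apply locally_Cmod; exists (Cmod (z - c) - r); split; [lra|easy]. }
  pose proof (Cmod_triangle (- (w - z)) (w - c)) as H3.
  replace (- (w - z) + (w - c))%C with (z - c)%C in H3 by ring.
  rewrite Cmod_opp in H3; lra.
- intros Hz V HV; apply locally_Cmod in HV; destruct HV as [d [Hd HV]].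
  pose proof (Cmod_ge_0 (z - c)) as H0.
  set (t := Rmin (/ 2) (d / (2 * (r + 1)))).
  assert (Ht : 0 < t) by (apply Rmin_glb_lt; [lra|apply Rdiv_lt_0_compat; lra]).
  assert (Ht1 : t <= / 2) by apply Rmin_l.
  assert (Ht2 : t * (r + 1) <= d / 2).
  { replace (d / 2) with (d / (2 * (r + 1)) * (r + 1)) by (field; lra).
    apply Rmult_le_compat_r; [lra|apply Rmin_r]. }
  exists (c + RtoC (1 - t) * (z - c))%C; split.
  + apply HV.
    replace (c + RtoC (1 - t) * (z - c) - z)%C with (- (RtoC t * (z - c)))%C
      by (rewrite RtoC_minus; ring).
    rewrite Cmod_opp, Cmod_mult, Cmod_R, Rabs_pos_eq by lra; nra.
  + replace (c + RtoC (1 - t) * (z - c) - c)%C with (RtoC (1 - t) * (z - c))%C by ring.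
    rewrite Cmod_mult, Cmod_R, Rabs_pos_eq by lra; nra.
Qed.

(** Heine-Cantor through a gauge on the square [[-1, 1] x [-1, 1]]. Points of the square outside the
    disc get a radius that keeps them away from the disc, so they are never selected. *)
Lemma disc_uniformly_continuous (F : C -> C) :
  (forall z eps, Cmod z <= 1 -> 0 < eps -> exists d, 0 < d /\
     forall w, Cmod w <= 1 -> Cmod (w - z) < d -> Cmod (F w - F z) < eps) ->
  forall eps, 0 < eps -> exists d, 0 < d /\
     forall z w, Cmod z <= 1 -> Cmod w <= 1 -> Cmod (w - z) < d -> Cmod (F w - F z) < eps.
Proof.
intros H eps He.
set (gauge := fun (u v : R) (d : posreal) =>
  (Cmod (u, v) <= 1 -> forall w, Cmod w <= 1 -> Cmod (w - (u, v)) < 4 * d ->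
     Cmod (F w - F (u, v)) < eps / 2) /\
  (1 < Cmod (u, v) -> forall w, Cmod w <= 1 -> 2 * d <= Cmod (w - (u, v)))).
assert (Hg : forall u v, exists d, gauge u v d).
{ intros u v; destruct (Rle_dec (Cmod (u, v)) 1) as [Huv|Huv].
  - destruct (H (u, v) (eps / 2) Huv ltac:(lra)) as [d [Hd Hw]].
    assert (Hd4 : 0 < d / 4) by lra.
    exists (mkposreal (d / 4) Hd4); split; [|lra].
    intros _ w Hw1 Hw2; apply Hw; [assumption|simpl in Hw2; lra].
  - assert (Hd : 0 < (Cmod (u, v) - 1) / 2) by lra.
    exists (mkposreal _ Hd); split; [lra|].
    intros _ w Hw; simpl pos.
    assert (Ht : forall p : C, Cmod p <= Cmod (w - p) + Cmod w).
    { intros p; rewrite Cmod_sub_sym; replace p with ((p - w) + w)%C at 1 by ring.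
      apply Cmod_triangle. }
    specialize (Ht (u, v)); lra. }
set (delta := fun u v => epsilon (inhabits (mkposreal 1 Rlt_0_1)) (gauge u v)).
assert (Hdelta : forall u v, gauge u v (delta u v))
  by (intros u v; unfold delta; apply epsilon_spec, Hg).
destruct (compactness_value_2d (-1) 1 (-1) 1 delta) as [d Hd].
exists d; split; [apply cond_pos|]; intros z w Hz Hw Hzw.
(* [compactness_value_2d] gives the gauge point only under a double negation, hence the passage to a
   contradiction. *)
destruct (excluded_middle_informative (Cmod (F w - F z) < eps)) as [|Hn]; [assumption|exfalso].
pose proof (abs_fst_le z) as Hz1; pose proof (abs_snd_le z) as Hz2.
apply (Hd (fst z) (snd z)); [apply Rabs_le_between; lra|apply Rabs_le_between; lra|].
intros [u [v [_ [_ [H1 [H2 H3]]]]]]; apply Hn.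
destruct (Hdelta u v) as [Hin Hout].
assert (Hd2 : Cmod (z - (u, v)) < 2 * delta u v).
{ eapply Rle_lt_trans; [apply Cmod_le_abs|]; simpl; unfold Rminus in H1, H2; lra. }
destruct (Rle_dec (Cmod (u, v)) 1) as [Huv|Huv].
- assert (Hw2 : Cmod (w - (u, v)) < 4 * delta u v).
  { replace (w - (u, v))%C with ((w - z) + (z - (u, v)))%C by ring.
    pose proof (cond_pos (delta u v)).
    eapply Rle_lt_trans; [apply Cmod_triangle|]; lra. }
  pose proof (Hin Huv w Hw Hw2) as E1.
  pose proof (cond_pos (delta u v)).
  pose proof (Hin Huv z Hz ltac:(lra)) as E2.
  replace (F w - F z)%C with ((F w - F (u, v)) - (F z - F (u, v)))%C by ring.
  eapply Rle_lt_trans; [apply Cmod_minus_le|]; lra.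
- specialize (Hout ltac:(lra) z Hz); lra.
Qed.

(** Going from [z] to [0] along the radius in steps of length at most [d / 2] changes [F] by less
    than [1] each time. In the induction one step is the contraction by [n / (n + 1)]. *)
Lemma disc_bounded (F : C -> C) (d : R) : 0 < d ->
  (forall z w, Cmod z <= 1 -> Cmod w <= 1 -> Cmod (w - z) < d -> Cmod (F w - F z) < 1) ->
  exists M, forall z, Cmod z <= 1 -> Cmod (F z) <= M.
Proof.
intros Hd HF.
assert (H : forall n z, Cmod z <= 1 -> Cmod z <= INR n * (d / 2) ->
          Cmod (F z) <= Cmod (F 0) + INR n).
{ induction n as [|n IH]; intros z Hz1 Hzn.
  - simpl in Hzn |- *; rewrite Rmult_0_l in Hzn.
    assert (Hz0 : z = RtoC 0) by (apply Cmod_eq_0; pose proof (Cmod_ge_0 z); lra).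
    subst; lra.
  - rewrite S_INR in *; pose proof (pos_INR n) as Hn.
    set (t := / (INR n + 1)).
    assert (Ht : 0 < t) by (apply Rinv_0_lt_compat; lra).
    assert (Htn : t * (INR n + 1) = 1) by (apply Rinv_l; lra).
    assert (Ht1 : t <= 1) by nra.
    pose proof (Cmod_ge_0 z).
    assert (Hw : Cmod (RtoC (1 - t) * z) = (1 - t) * Cmod z)
      by (rewrite Cmod_mult, Cmod_R, Rabs_pos_eq by lra; reflexivity).
    assert (E1 : Cmod (F (RtoC (1 - t) * z)%C) <= Cmod (F 0) + INR n).
    { apply IH; rewrite Hw; [nra|].
      apply Rle_trans with ((1 - t) * ((INR n + 1) * (d / 2))).
      - apply Rmult_le_compat_l; lra.
      - nra. }
    assert (E2 : Cmod (F z - F (RtoC (1 - t) * z)%C) < 1).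
    { apply HF; [rewrite Hw; nra|assumption|].
      replace (z - RtoC (1 - t) * z)%C with (RtoC t * z)%C by (rewrite RtoC_minus; ring).
      rewrite Cmod_mult, Cmod_R, Rabs_pos_eq by lra.
      apply Rle_lt_trans with (t * ((INR n + 1) * (d / 2))).
      - apply Rmult_le_compat_l; lra.
      - rewrite <- Rmult_assoc, Htn; lra. }
    replace (F z) with ((F z - F (RtoC (1 - t) * z)) + F (RtoC (1 - t) * z))%C by ring.
    eapply Rle_trans; [apply Cmod_triangle|]; lra. }
destruct (archimed_cor1 (d / 2) ltac:(lra)) as [n [Hn Hn0]].
exists (Cmod (F 0) + INR n); intros z Hz; apply H; [assumption|].
assert (HnR : 0 < INR n) by (apply lt_0_INR; lia).
apply Rmult_lt_compat_l with (r := INR n) in Hn; [|assumption].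
rewrite Rinv_r in Hn by lra; lra.
Qed.

Lemma cdiff_peval l z : cdiff (peval l) z.
Proof.
induction l as [|x l IH].
- apply cdiff_ext with (fun w => (0 + 0 * w)%C); [intros; simpl; ring|apply cdiff_affine].
- apply cdiff_ext with (fun w => (x + 1 * (w * peval l w))%C); [intros; simpl; ring|].
  apply (cdiff_comp (fun w => (x + 1 * w)%C) (fun w => (w * peval l w)%C)); [apply cdiff_affine|].
  apply cdiff_mult; [|assumption].
  apply cdiff_ext with (fun w => (0 + 1 * w)%C); [intros; ring|apply cdiff_affine].
Qed.

(** The logarithmic coordinates miss [0] and stay inside the open disc; the bound reaches the origin
    and the boundary circle by continuity of [F] and of the polynomial. *)
Lemma polynomial_approx_disc (F : C -> C) :
  (forall z, Cmod z < 1 -> cdiff F z) ->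
  (forall z eps, Cmod z <= 1 -> 0 < eps -> exists d, 0 < d /\
     forall w, Cmod w <= 1 -> Cmod (w - z) < d -> Cmod (F w - F z) < eps) ->
  forall eps, 0 < eps -> exists P : list C, forall z, Cmod z <= 1 ->
    Cmod (peval P z - F z) <= eps.
Proof.
intros HF Hcont eps He.
pose proof (disc_uniformly_continuous F Hcont) as Hu.
destruct (Hu 1 ltac:(lra)) as [d1 [Hd1 Hu1]].
destruct (disc_bounded F d1 Hd1 Hu1) as [M HM].
assert (HM0 : 0 <= M).
{ eapply Rle_trans; [apply Cmod_ge_0|apply (HM 0)]; rewrite Cmod_0; lra. }
assert (Hkor : forall e, 0 < e -> exists B, 0 <= B /\ forall z w, Cmod z < 1 -> Cmod w < 1 ->
     Cmod (F z - F w) <= e + B * Cmod (z - w) ^ 2).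
{ intros e Hee; destruct (Hu e Hee) as [d [Hd Hd']].
  assert (HB : 0 <= 2 * M / d ^ 2).
  { apply Rmult_le_pos; [lra|]; left; apply Rinv_0_lt_compat, pow_lt, Hd. }
  (* For points at distance at least [d] the quadratic term exceeds the trivial bound [2 * M]. *)
  exists (2 * M / d ^ 2); split; [exact HB|].
  intros z w Hz Hw.
  assert (H0 : 0 <= 2 * M / d ^ 2 * Cmod (z - w) ^ 2)
    by (apply Rmult_le_pos; [exact HB|apply pow_le, Cmod_ge_0]).
  destruct (Rlt_le_dec (Cmod (z - w)) d) as [Hlt|Hge].
  + pose proof (Hd' w z ltac:(lra) ltac:(lra) Hlt); lra.
  + assert (Hsq : d ^ 2 <= Cmod (z - w) ^ 2) by (apply pow_incr; lra).
    assert (2 * M <= 2 * M / d ^ 2 * Cmod (z - w) ^ 2).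
    { replace (2 * M) with (2 * M / d ^ 2 * d ^ 2) at 1 by (field; lra).
      now apply Rmult_le_compat_l. }
    pose proof (Cmod_minus_le (F z) (F w)).
    pose proof (HM z ltac:(lra)); pose proof (HM w ltac:(lra)); lra. }
destruct (polynomial_approx_punctured F M HF (fun z Hz => HM z (Rlt_le _ _ Hz)) Hkor
  (eps / 3) ltac:(lra)) as [P HP].
exists P; intros z Hz.
destruct (Hcont z (eps / 3) Hz ltac:(lra)) as [d [Hd HFd]].
destruct (cdiff_continuous (peval P) z (eps / 3) (cdiff_peval P z) ltac:(lra)) as [d' [Hd' HPd]].
set (t := Rmin (/ 2) (Rmin (d / 2) (d' / 2))).
assert (Ht : 0 < t <= / 2 /\ t <= d / 2 /\ t <= d' / 2).
{ unfold t, Rmin; repeat destruct Rle_dec; lra. }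
assert (Hw : exists w, w <> RtoC 0 /\ Cmod w < 1 /\ Cmod (w - z) <= t).
{ destruct (excluded_middle_informative (z = RtoC 0)) as [->|Hz0].
  - exists (RtoC t); split; [|split].
    + intros E; apply RtoC_inj in E; lra.
    + rewrite Cmod_R, Rabs_pos_eq; lra.
    + replace (RtoC t - 0)%C with (RtoC t) by ring; rewrite Cmod_R, Rabs_pos_eq; lra.
  - exists (RtoC (1 - t) * z)%C; apply Cmod_gt_0 in Hz0; split; [|split].
    + apply Cmod_gt_0; rewrite Cmod_mult, Cmod_R, Rabs_pos_eq by lra.
      apply Rmult_lt_0_compat; lra.
    + rewrite Cmod_mult, Cmod_R, Rabs_pos_eq by lra; nra.
    + replace (RtoC (1 - t) * z - z)%C with (- (RtoC t * z))%C by (rewrite RtoC_minus; ring).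
      rewrite Cmod_opp, Cmod_mult, Cmod_R, Rabs_pos_eq by lra; nra. }
destruct Hw as [w [Hw0 [Hw1 Hwz]]].
specialize (HP w Hw0 Hw1); specialize (HFd w ltac:(lra) ltac:(lra)).
specialize (HPd w ltac:(lra)).
replace (peval P z - F z)%C
  with ((peval P w - F w) + (F w - F z) - (peval P w - peval P z))%C by ring.
eapply Rle_trans; [apply Cmod_minus_le|].
eapply Rle_trans; [apply Rplus_le_compat_r, Cmod_triangle|]; lra.
Qed.

Lemma polynomials_dense_in_A_disc (c : C) (g : C -> C) (eps : R) :
  in_A (closure (open_disc c 1)) g -> 0 < eps ->
  exists P : list C, forall z, Cmod (z - c) <= 1 -> Cmod (peval P (z - c) - g z) <= eps.
Proof.
intros [Hc Hh] He.
assert (Hcl : forall z, Cmod (z - c) <= 1 <-> closure (open_disc c 1) z)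
  by (intros z; symmetry; apply closure_open_disc; lra).
destruct (polynomial_approx_disc (fun w => g (c + 1 * w)%C)) with (eps := eps) as [P HP].
- intros z Hz; apply (cdiff_comp g (fun w => (c + 1 * w)%C)); [|apply cdiff_affine].
  apply ex_derive_cdiff, ex_derive_C_NormedModule, Hh.
  apply locally_Cmod; exists (1 - Cmod z); split; [lra|]; intros w Hw.
  apply Hcl; replace (w - c)%C with ((w - (c + 1 * z)) + z)%C by ring.
  eapply Rle_trans; [apply Cmod_triangle|]; lra.
- intros z e Hz Hee.
  assert (Hzc : closure (open_disc c 1) (c + 1 * z)%C).
  { apply Hcl; replace (c + 1 * z - c)%C with z by ring; assumption. }
  assert (Hl : locally (g (c + 1 * z)%C) (fun y : C => Cmod (y - g (c + 1 * z)%C) < e))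
    by (apply locally_Cmod; exists e; split; [assumption|easy]).
  pose proof (Hc _ Hzc _ Hl) as Hw; unfold filtermap, within in Hw.
  apply locally_Cmod in Hw; destruct Hw as [d [Hd Hw]].
  exists d; split; [assumption|]; intros w Hw1 Hwz; apply Hw.
  + replace (c + 1 * w - (c + 1 * z))%C with (w - z)%C by ring; assumption.
  + apply Hcl; replace (c + 1 * w - c)%C with w by ring; assumption.
- assumption.
- exists P; intros z Hz; specialize (HP _ Hz).
  replace (c + 1 * (z - c))%C with z in HP by ring; exact HP.
Qed.

(** * Complex power series with bounded coefficients *)

Lemma peval_truncation_S (a : nat -> C) (n : nat) (z : C) :
  peval (truncation a (S n)) z = (peval (truncation a n) z + a n * z ^ n)%C.
Proof.
unfold truncation; rewrite seq_S, map_app, peval_app, length_map, length_seq; simpl; ring.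
Qed.

Lemma pnorm_truncation_S (a : nat -> C) (n : nat) (t : R) :
  pnorm t (truncation a (S n)) = pnorm t (truncation a n) + Cmod (a n) * t ^ n.
Proof.
unfold truncation; rewrite seq_S, map_app, pnorm_app, length_map, length_seq; simpl; ring.
Qed.

Lemma sum_n_peval (a : nat -> C) (n : nat) (z : C) :
  sum_n (fun k => (a k * z ^ k)%C) n = peval (truncation a (S n)) z.
Proof.
induction n as [|n IH].
- rewrite sum_O; simpl; ring.
- rewrite sum_Sn, IH, (peval_truncation_S a (S n)); reflexivity.
Qed.

Definition pseries_lim (a : nat -> C) (z l : C) : Prop :=
  forall eps, 0 < eps -> exists N, forall n, (N <= n)%nat ->
    Cmod (peval (truncation a n) z - l) < eps.

Lemma pow_n_Cpow (z : C) (k : nat) : @pow_n C_AbsRing z k = (z ^ k)%C.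
Proof. induction k as [|k IH]; simpl; [reflexivity|rewrite IH; reflexivity]. Qed.

Lemma is_pseries_iff (a : nat -> C) (z l : C) :
  @is_pseries C_AbsRing C_NormedModule a z l <-> pseries_lim a z l.
Proof.
assert (Hsum : forall n,
  @sum_n C_AbelianGroup (fun k => @scal C_AbsRing C_NormedModule (pow_n z k) (a k)) n
  = peval (truncation a (S n)) z).
{ intros n; rewrite <- sum_n_peval; apply sum_n_ext; intros k.
  rewrite pow_n_Cpow; apply Cmult_comm. }
split.
- intros H eps He.
  assert (Hl : locally l (fun y : C => Cmod (y - l) < eps))
    by (apply locally_Cmod; exists eps; split; [assumption|easy]).
  destruct (H _ Hl) as [N HN]; exists (S N); intros [|n] Hn; [lia|].
  rewrite <- Hsum; apply HN; lia.
- intros H P HP; apply locally_Cmod in HP; destruct HP as [d [Hd HP]].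
  destruct (H d Hd) as [N HN]; exists N; intros n Hn; apply HP.
  rewrite Hsum; apply HN; lia.
Qed.

Lemma pseries_lim_unique a z l l' : pseries_lim a z l -> pseries_lim a z l' -> l = l'.
Proof.
intros H H'.
assert (E : (l - l')%C = RtoC 0).
{ apply Cmod_eq_0, Rle_antisym; [|apply Cmod_ge_0].
  apply Rnot_lt_le; intros Hpos; set (e := Cmod (l - l')) in *.
  destruct (H (e / 2) ltac:(lra)) as [N HN], (H' (e / 2) ltac:(lra)) as [N' HN'].
  specialize (HN (N + N')%nat ltac:(lia)); specialize (HN' (N + N')%nat ltac:(lia)).
  set (p := peval (truncation a (N + N')) z) in *.
  pose proof (Cmod_minus_le (p - l') (p - l)) as Ht.
  replace (p - l' - (p - l))%C with (l - l')%C in Ht by ring; fold e in Ht; lra. }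
replace l with ((l - l') + l')%C by ring; rewrite E; ring.
Qed.

Definition bounded_coefs (a : nat -> C) (M : R) : Prop := forall k, Cmod (a k) <= M.

Lemma bounded_coefs_ge0 a M : bounded_coefs a M -> 0 <= M.
Proof. intros H; eapply Rle_trans; [apply Cmod_ge_0|apply (H 0%nat)]. Qed.

Lemma pnorm_truncation_le a M t n : bounded_coefs a M -> 0 <= t < 1 ->
  pnorm t (truncation a n) <= M / (1 - t).
Proof.
intros Ha Ht; pose proof (bounded_coefs_ge0 a M Ha) as HM.
assert (H : pnorm t (truncation a n) <= M / (1 - t) * (1 - t ^ n)).
{ induction n as [|n IH]; [simpl; lra|].
  rewrite pnorm_truncation_S.
  replace (M / (1 - t) * (1 - t ^ S n)) with (M / (1 - t) * (1 - t ^ n) + M * t ^ n)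
    by (simpl; field; lra).
  apply Rplus_le_compat; [assumption|].
  apply Rmult_le_compat_r; [apply pow_le; lra|apply Ha]. }
pose proof (pow_le t n (proj1 Ht)).
assert (0 <= M / (1 - t)) by (apply Rmult_le_pos; [lra|left; apply Rinv_0_lt_compat; lra]).
nra.
Qed.

Lemma ex_pseries_lim a M z : bounded_coefs a M -> Cmod z < 1 -> exists l, pseries_lim a z l.
Proof.
intros Ha Hz.
destruct (ex_series_le (K := C_AbsRing) (V := C_CompleteNormedModule)
  (fun k => scal (pow_n z k) (a k)) (fun k => M * Cmod z ^ k)) as [l Hl].
- intros k; rewrite pow_n_Cpow.
  change (Cmod (z ^ k * a k) <= M * Cmod z ^ k).
  rewrite Cmod_mult, Cmod_pow, Rmult_comm.
  apply Rmult_le_compat_r; [apply pow_le, Cmod_ge_0|apply Ha].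
- apply (ex_series_scal_l (V := R_NormedModule) M), ex_series_geom.
  rewrite Rabs_pos_eq; [assumption|apply Cmod_ge_0].
- exists l; apply is_pseries_iff; exact Hl.
Qed.

Definition pseries (a : nat -> C) (z : C) : C := epsilon (inhabits (RtoC 0)) (pseries_lim a z).

Lemma pseries_correct a M z : bounded_coefs a M -> Cmod z < 1 ->
  pseries_lim a z (pseries a z).
Proof. intros Ha Hz; unfold pseries; apply epsilon_spec; now apply (ex_pseries_lim a M). Qed.

Lemma Cmod_pseries_le a M z : bounded_coefs a M -> Cmod z < 1 ->
  Cmod (pseries a z) <= M / (1 - Cmod z).
Proof.
intros Ha Hz; apply Rnot_lt_le; intros Hlt.
destruct (pseries_correct a M z Ha Hz (Cmod (pseries a z) - M / (1 - Cmod z)) ltac:(lra))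
  as [N HN].
specialize (HN N (Nat.le_refl N)).
pose proof (pnorm_truncation_le a M (Cmod z) N Ha (conj (Cmod_ge_0 z) Hz)).
pose proof (Cmod_peval_le (truncation a N) z (Cmod z) (Rle_refl _)).
set (p := peval (truncation a N) z) in *.
pose proof (Cmod_minus_le p (p - pseries a z)) as Ht.
replace (p - (p - pseries a z))%C with (pseries a z) in Ht by ring; lra.
Qed.

(** The series with its first [n] terms removed, divided by [z^n]. *)
Definition tail_coefs (a : nat -> C) (n : nat) : nat -> C := fun k => a (n + k)%nat.

Lemma bounded_tail_coefs a M n : bounded_coefs a M -> bounded_coefs (tail_coefs a n) M.
Proof. intros Ha k; apply Ha. Qed.

Lemma peval_truncation_tail (a : nat -> C) (n m : nat) (z : C) :
  peval (truncation (tail_coefs a n) (S m)) z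
  = (a n + z * peval (truncation (tail_coefs a (S n)) m) z)%C.
Proof.
unfold truncation, tail_coefs; cbn [seq map peval].
rewrite Nat.add_0_r, <- seq_shift, map_map; do 3 f_equal.
apply map_ext; intros k; f_equal; lia.
Qed.

Lemma pseries_tail a M n z : bounded_coefs a M -> Cmod z < 1 ->
  pseries (tail_coefs a n) z = (a n + z * pseries (tail_coefs a (S n)) z)%C.
Proof.
intros Ha Hz; apply (pseries_lim_unique (tail_coefs a n) z).
- apply (pseries_correct _ M); [now apply bounded_tail_coefs|assumption].
- intros eps He.
  destruct (pseries_correct _ M z (bounded_tail_coefs a M (S n) Ha) Hz eps He) as [N HN].
  exists (S N); intros [|m] Hm; [lia|].
  rewrite peval_truncation_tail.
  replace (a n + z * peval (truncation (tail_coefs a (S n)) m) z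
    - (a n + z * pseries (tail_coefs a (S n)) z))%C
    with (z * (peval (truncation (tail_coefs a (S n)) m) z - pseries (tail_coefs a (S n)) z))%C
    by ring.
  rewrite Cmod_mult; specialize (HN m ltac:(lia)).
  pose proof (Cmod_ge_0 z).
  pose proof (Cmod_ge_0 (peval (truncation (tail_coefs a (S n)) m) z - pseries (tail_coefs a (S n)) z)).
  nra.
Qed.

(* The coefficients of the difference quotient of [pseries a] at [z0]. *)
Definition quotient_coefs (a : nat -> C) (z0 : C) : nat -> C :=
  fun n => pseries (tail_coefs a (S n)) z0.

Lemma bounded_quotient_coefs a M z0 : bounded_coefs a M -> Cmod z0 < 1 ->
  bounded_coefs (quotient_coefs a z0) (M / (1 - Cmod z0)).
Proof. intros Ha Hz k; apply Cmod_pseries_le; [now apply bounded_tail_coefs|assumption]. Qed.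

(** Synthetic division by [z - z0] carried to order [n]. The term in [z^n] is the remainder not yet
    divided; it tends to [0] for [Cmod z < 1] because the tails are bounded at [z0]. *)
Lemma quotient_coefs_truncation a M z0 z n : bounded_coefs a M -> Cmod z0 < 1 ->
  (peval (truncation a n) z - pseries a z0 + pseries (tail_coefs a n) z0 * z ^ n)%C
  = ((z - z0) * peval (truncation (quotient_coefs a z0) n) z)%C.
Proof.
intros Ha Hz0; induction n as [|n IH].
- simpl; change (tail_coefs a 0) with a; ring.
- rewrite !peval_truncation_S, Cmult_plus_distr_l, <- IH.
  rewrite (pseries_tail a M n z0 Ha Hz0).
  change (quotient_coefs a z0 n) with (pseries (tail_coefs a (S n)) z0).
  rewrite Cpow_S; ring.
Qed.

Lemma pseries_difference a M z0 z : bounded_coefs a M -> Cmod z0 < 1 -> Cmod z < 1 ->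
  (pseries a z - pseries a z0)%C = ((z - z0) * pseries (quotient_coefs a z0) z)%C.
Proof.
intros Ha Hz0 Hz.
set (b := quotient_coefs a z0).
assert (Hb : bounded_coefs b (M / (1 - Cmod z0))) by now apply bounded_quotient_coefs.
pose proof (bounded_coefs_ge0 _ _ Hb) as HM'.
set (M' := M / (1 - Cmod z0)) in *.
assert (E : (pseries a z - pseries a z0 - (z - z0) * pseries b z)%C = RtoC 0).
{ apply Cmod_eq_0, Rle_antisym; [|apply Cmod_ge_0].
  apply Rnot_lt_le; intros Hpos.
  set (e := Cmod (pseries a z - pseries a z0 - (z - z0) * pseries b z)) in *.
  (* The two truncations and the remainder cost [e / 8], [2 * e / 8] and [e / 8], since
     [Cmod (z - z0) <= 2]; together less than [e]. *)
  destruct (pseries_correct a M z Ha Hz (e / 8) ltac:(lra)) as [N1 H1].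
  destruct (pseries_correct b M' z Hb Hz (e / 8) ltac:(lra)) as [N2 H2].
  destruct (pow_lt_1_zero (Cmod z)
    ltac:(rewrite Rabs_pos_eq; [assumption|apply Cmod_ge_0]) (e / (8 * (M' + 1)))) as [N3 H3].
  { apply Rdiv_lt_0_compat; lra. }
  set (n := (N1 + N2 + N3)%nat).
  specialize (H1 n ltac:(lia)); specialize (H2 n ltac:(lia)); specialize (H3 n ltac:(lia)).
  rewrite Rabs_pos_eq in H3 by (apply pow_le, Cmod_ge_0).
  pose proof (quotient_coefs_truncation a M z0 z n Ha Hz0) as Hq; fold b in Hq.
  set (p := peval (truncation a n) z) in *; set (q := peval (truncation b n) z) in *.
  set (G := pseries (tail_coefs a n) z0) in *.
  assert (HG : Cmod G <= M')
    by (apply Cmod_pseries_le; [now apply bounded_tail_coefs|assumption]).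
  assert (HGz : Cmod (G * z ^ n) <= e / 8).
  { rewrite Cmod_mult, Cmod_pow.
    apply Rle_trans with (M' * (e / (8 * (M' + 1)))).
    - apply Rmult_le_compat; [apply Cmod_ge_0|apply pow_le, Cmod_ge_0|assumption|lra].
    - replace (M' * (e / (8 * (M' + 1)))) with (e / 8 * (M' / (M' + 1))) by (field; lra).
      assert (M' / (M' + 1) <= 1).
      { apply Rmult_le_reg_r with (M' + 1); [lra|].
        unfold Rdiv; rewrite Rmult_assoc, Rinv_l; lra. }
      nra. }
  assert (He : e <= Cmod (p - pseries a z) + Cmod (G * z ^ n) + Cmod ((z - z0) * (q - pseries b z))).
  { unfold e.
    replace (pseries a z - pseries a z0 - (z - z0) * pseries b z)%C
      with (((p - pseries a z0 + G * z ^ n) - (z - z0) * q)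
        + ((z - z0) * (q - pseries b z) - (p - pseries a z) - G * z ^ n))%C by ring.
    rewrite Hq.
    replace ((z - z0) * q - (z - z0) * q)%C with (RtoC 0) by ring; rewrite Cplus_0_l.
    eapply Rle_trans; [apply Cmod_minus_le|].
    pose proof (Cmod_minus_le ((z - z0) * (q - pseries b z)) (p - pseries a z)); lra. }
  rewrite (Cmod_mult (z - z0)) in He.
  pose proof (Cmod_minus_le z z0) as Hzz; pose proof (Cmod_ge_0 (z - z0)).
  pose proof (Cmod_ge_0 (q - pseries b z)).
  assert (Cmod (z - z0) * Cmod (q - pseries b z) <= 2 * (e / 8))
    by (apply Rmult_le_compat; lra).
  lra. }
replace (pseries a z - pseries a z0)%C
  with ((pseries a z - pseries a z0 - (z - z0) * pseries b z) + (z - z0) * pseries b z)%C by ring.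
rewrite E; ring.
Qed.

(** Dividing twice by [z - z0] gives [f z = f z0 + (z - z0) * b z0 + (z - z0)^2 * b2 z], with [b2]
    bounded where [Cmod z <= 1 - r]; so [b z0] is the derivative. *)
Lemma cdiff_pseries a M z0 : bounded_coefs a M -> Cmod z0 < 1 -> cdiff (pseries a) z0.
Proof.
intros Ha Hz0.
set (b := quotient_coefs a z0).
assert (Hb : bounded_coefs b (M / (1 - Cmod z0))) by now apply bounded_quotient_coefs.
set (b2 := quotient_coefs b z0).
pose proof (bounded_quotient_coefs b _ z0 Hb Hz0) as Hb2; fold b2 in Hb2.
set (M2 := M / (1 - Cmod z0) / (1 - Cmod z0)) in *.
pose proof (bounded_coefs_ge0 _ _ Hb2) as HM2.
set (r := (1 - Cmod z0) / 2).
assert (Hr : 0 < r) by (unfold r; lra).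
exists (pseries b z0); intros eps He.
assert (HMr : 0 < M2 / r + 1)
  by (pose proof (Rmult_le_pos M2 (/ r) HM2 (Rlt_le _ _ (Rinv_0_lt_compat r Hr))); unfold Rdiv; lra).
exists (Rmin r (eps / (M2 / r + 1))); split.
{ apply Rmin_glb_lt; [assumption|now apply Rdiv_lt_0_compat]. }
intros z Hz.
assert (Hz1 : Cmod (z - z0) < r) by (eapply Rlt_le_trans; [exact Hz|apply Rmin_l]).
assert (Hz2 : Cmod (z - z0) < eps / (M2 / r + 1))
  by (eapply Rlt_le_trans; [exact Hz|apply Rmin_r]).
assert (Hzr : Cmod z <= 1 - r).
{ replace z with ((z - z0) + z0)%C by ring.
  eapply Rle_trans; [apply Cmod_triangle|]; unfold r in *; lra. }
rewrite (pseries_difference a M) by (try assumption; lra); fold b.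
replace ((z - z0) * pseries b z - pseries b z0 * (z - z0))%C
  with ((z - z0) * (pseries b z - pseries b z0))%C by ring.
rewrite (pseries_difference b _ z0 z Hb) by (try assumption; lra); fold b2.
rewrite !Cmod_mult, Rmult_comm.
apply Rmult_le_compat_r; [apply Cmod_ge_0|].
assert (HB2 : Cmod (pseries b2 z) <= M2 / r + 1).
{ eapply Rle_trans; [apply (Cmod_pseries_le b2 M2); [assumption|lra]|].
  assert (M2 / (1 - Cmod z) <= M2 / r); [|lra].
  apply Rmult_le_compat_l; [assumption|apply Rinv_le_contravar; lra]. }
replace eps with (eps / (M2 / r + 1) * (M2 / r + 1)) by (field; lra).
apply Rmult_le_compat; try apply Cmod_ge_0; lra.
Qed.

(** * Uniqueness of Taylor coefficients *)

Lemma real_pseries_ext (a b : nat -> R) (f : R -> R) :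
  (forall x, Rabs x < 1 -> is_pseries a x (f x)) ->
  (forall x, Rabs x < 1 -> is_pseries b x (f x)) -> forall n, a n = b n.
Proof.
intros Ha Hb n.
assert (Hrad : forall c : nat -> R, (forall x, Rabs x < 1 -> is_pseries c x (f x)) ->
          Rbar_lt 0 (CV_radius c)).
{ intros c Hc.
  assert (Hhalf : Rabs (/ 2) < 1) by (rewrite Rabs_pos_eq; lra).
  destruct (Rbar_lt_dec 0 (CV_radius c)) as [|Hn]; [assumption|exfalso].
  (* Outside the disc of convergence the terms do not tend to [0], whereas the series converges at
     [/ 2]. *)
  apply (CV_disk_outside c (/ 2)).
  - apply Rbar_not_lt_le in Hn; eapply Rbar_le_lt_trans; [exact Hn|].
    simpl; apply Rabs_pos_lt; lra.
  - apply ex_series_lim_0; exists (f (/ 2)).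
    exact (proj1 (is_pseries_R c (/ 2) _) (Hc _ Hhalf)). }
apply PSeries_ext_recip; [now apply Hrad|now apply Hrad|].
exists (mkposreal 1 Rlt_0_1); intros x Hx.
assert (Hx1 : Rabs x < 1).
{ replace x with (minus x 0) by (unfold minus, plus, opp; simpl; ring); exact Hx. }
now rewrite (is_pseries_unique _ _ _ (Ha x Hx1)), (is_pseries_unique _ _ _ (Hb x Hx1)).
Qed.

Lemma is_pseries_components (a : nat -> C) (x : R) (l : C) :
  pseries_lim a (RtoC x) l ->
  is_pseries (fun k => fst (a k)) x (fst l) /\ is_pseries (fun k => snd (a k)) x (snd l).
Proof.
intros H.
assert (Hfst : forall n, sum_n (fun k => fst (a k) * x ^ k) n
          = fst (peval (truncation a (S n)) (RtoC x))).
{ induction n as [|n IH].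
  - rewrite sum_O; simpl; ring.
  - rewrite sum_Sn, IH, (peval_truncation_S a (S n)), <- RtoC_pow.
    generalize (peval (truncation a (S n)) (RtoC x)) (a (S n)) (x ^ S n).
    intros p q y; unfold plus; simpl; ring. }
assert (Hsnd : forall n, sum_n (fun k => snd (a k) * x ^ k) n
          = snd (peval (truncation a (S n)) (RtoC x))).
{ induction n as [|n IH].
  - rewrite sum_O; simpl; ring.
  - rewrite sum_Sn, IH, (peval_truncation_S a (S n)), <- RtoC_pow.
    generalize (peval (truncation a (S n)) (RtoC x)) (a (S n)) (x ^ S n).
    intros p q y; unfold plus; simpl; ring. }
split; apply is_pseries_R; intros P [eps HP]; destruct (H eps (cond_pos eps)) as [N HN];
  exists N; intros n Hn; apply HP; specialize (HN (S n) ltac:(lia));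
  (eapply Rle_lt_trans; [|exact HN]).
- rewrite Hfst; exact (abs_fst_le (peval (truncation a (S n)) (RtoC x) - l)).
- rewrite Hsnd; exact (abs_snd_le (peval (truncation a (S n)) (RtoC x) - l)).
Qed.

(** On the real axis the powers are real, so the expansion splits into two real power series and the
    real identity theorem applies to each. *)
Lemma taylor_expansion_unique (f : C -> C) (a b : nat -> C) :
  is_taylor_expansion f a -> is_taylor_expansion f b -> forall n, a n = b n.
Proof.
intros Ha Hb n.
assert (Hreal : forall c, is_taylor_expansion f c -> forall x, Rabs x < 1 ->
  is_pseries (fun k => fst (c k)) x (fst (f (RtoC x))) /\
  is_pseries (fun k => snd (c k)) x (snd (f (RtoC x)))).
{ intros c Hc x Hx; apply is_pseries_components, is_pseries_iff, Hc.
  unfold unit_disc, open_disc.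
  replace (RtoC x - RtoC 0)%C with (RtoC x) by ring; now rewrite Cmod_R. }
apply injective_projections.
- exact (real_pseries_ext _ _ (fun x => fst (f (RtoC x)))
    (fun x Hx => proj1 (Hreal a Ha x Hx)) (fun x Hx => proj1 (Hreal b Hb x Hx)) n).
- exact (real_pseries_ext _ _ (fun x => snd (f (RtoC x)))
    (fun x Hx => proj2 (Hreal a Ha x Hx)) (fun x Hx => proj2 (Hreal b Hb x Hx)) n).
Qed.

(** [taylor_coef] is a choice among expansions; one known expansion makes the choice valid, and
    uniqueness identifies it. *)
Lemma taylor_sum_eq (f : C -> C) (a : nat -> C) (n : nat) (z : C) :
  is_taylor_expansion f a -> taylor_sum n f z = peval (truncation a (S n)) z.
Proof.
intros Ha.
assert (Ht : is_taylor_expansion f (taylor_coef f))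
  by (unfold taylor_coef; apply epsilon_spec; now exists a).
rewrite <- sum_n_peval; unfold taylor_sum; apply sum_n_ext; intros k.
now rewrite (taylor_expansion_unique f _ _ Ht Ha).
Qed.

(** * The half-universal series *)

Lemma is_taylor_expansion_opp f a : is_taylor_expansion f a ->
  is_taylor_expansion (fun z => (- f z)%C) (fun k => (- a k)%C).
Proof.
intros H z Hz; apply is_pseries_iff; intros eps He.
destruct (proj1 (is_pseries_iff a z (f z)) (H z Hz) eps He) as [N HN].
assert (Hopp : forall n, peval (truncation (fun k => (- a k)%C) n) z
                  = (- peval (truncation a n) z)%C).
{ induction n as [|n IH]; [simpl; ring|].
  rewrite !peval_truncation_S, IH; ring. }
exists N; intros n Hn; rewrite Hopp.
replace (- peval (truncation a n) z - - f z)%C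
  with (- (peval (truncation a n) z - f z))%C by ring.
rewrite Cmod_opp; now apply HN.
Qed.

Lemma taylor_sum_opp (f : C -> C) (a : nat -> C) (n : nat) (z : C) :
  is_taylor_expansion f a -> taylor_sum n (fun z => (- f z)%C) z = (- taylor_sum n f z)%C.
Proof.
intros Ha.
rewrite (taylor_sum_eq _ _ n z Ha), (taylor_sum_eq _ _ n z (is_taylor_expansion_opp f a Ha)).
induction (S n) as [|m IH]; [simpl; ring|].
rewrite !peval_truncation_S, IH; ring.
Qed.

Lemma sup_norm_lt (K : C -> Prop) (h : C -> C) (d eps : R) :
  (forall z, K z -> Cmod (h z) <= d) -> d < eps -> Rbar_lt (sup_norm K h) eps.
Proof.
intros H Hd; unfold sup_norm.
apply Rbar_le_lt_trans with (Finite d); [|exact Hd].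
apply Lub_Rbar_correct; intros x [z [Hz ->]]; now apply H.
Qed.

Lemma lt_of_sup_norm_lt (K : C -> Prop) (h : C -> C) (eps : R) (z : C) :
  Rbar_lt (sup_norm K h) eps -> K z -> Cmod (h z) < eps.
Proof.
unfold sup_norm; intros H Hz.
pose proof (proj1 (Lub_Rbar_correct (fun x => exists z, K z /\ x = Cmod (h z))) (Cmod (h z))
  (ex_intro _ z (conj Hz eq_refl))) as Hle.
exact (Rbar_le_lt_trans _ _ _ Hle H).
Qed.

Lemma in_A_const (K : C -> Prop) (x : C) : in_A K (fun _ => x).
Proof.
split.
- apply continuous_on_forall; intros z _; apply continuous_const.
- intros z _; exists zero; apply (is_derive_const (K := C_AbsRing) (V := C_NormedModule)).
Qed.

Lemma peval_comp_affine (u v : C) (P : list C) :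
  exists p, forall w, peval p w = peval P (u + v * w)%C.
Proof.
induction P as [|x P [p Hp]].
- exists nil; reflexivity.
- exists (padd [x] (pmul [u; v] p)); intros w.
  rewrite peval_padd, peval_pmul, Hp; simpl; ring.
Qed.

(** [-3] is at distance [2] from both admissible regions; the bound [1] refutes approximation within
    [eps = 1]. *)
Lemma admissible_far (x : C) : admissible x -> 1 <= Cmod (x + 3).
Proof.
intros [H|H].
- pose proof (Cmod_minus_le (x + 3) 3) as Ht.
  replace (x + 3 - 3)%C with x in Ht by ring.
  rewrite Cmod_R, Rabs_pos_eq in Ht by lra; lra.
- pose proof (re_le_Cmod (x + 3)) as Ht; rewrite re_plus in Ht; simpl in Ht.
  pose proof (Rle_abs (Re x + 3)); lra.
Qed.

Lemma peval_truncation_scal (A : nat -> C) (t z : C) (n : nat) :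
  peval (truncation (fun k => (A k * t ^ k)%C) n) z = peval (truncation A n) (t * z).
Proof.
induction n as [|n IH]; [reflexivity|].
rewrite !peval_truncation_S, IH, Cpow_mult_l; ring.
Qed.

Theorem mainTheorem1 :
  exists (f : C -> C) (c : C) (r : R),
    let D := open_disc c r in
    holomorphic_on unit_disc f /\
    0 < r /\
    (forall z : C, D z -> ~ unit_disc z) /\
    dense_in_A (closure D)
      (fun p => taylor_sums f p \/ taylor_sums (fun z => (- f z)%C) p) /\
    ~ universal_taylor_series (closure D) f /\
    ~ universal_taylor_series (closure D) (fun z => (- f z)%C).
Proof.
destruct exists_half_universal_coefs as [A [HA1 [HA2 HA3]]].
set (t := RtoC (/ 16)).
(* Back from [w] to [z = 16 w]: the weight bound at radius [/ 16] becomes a uniform bound on the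
   coefficients [a], and [Cmod (w - 1) <= / 16] becomes the closed disc with centre [16] and radius
   [1]. *)
set (a := fun k => (A k * t ^ k)%C).
assert (Ht : Cmod t = / 16) by (unfold t; rewrite Cmod_R, Rabs_pos_eq; lra).
assert (Ht16 : (t * 16)%C = RtoC 1)
  by (unfold t; rewrite <- RtoC_mult; f_equal; field).
assert (Ha : bounded_coefs a 2).
{ intros k; unfold a; rewrite Cmod_mult, Cmod_pow, Ht.
  pose proof (HA1 (S k)) as H; rewrite pnorm_truncation_S in H.
  pose proof (pnorm_ge0 (/ 16) (truncation A k) ltac:(lra)); lra. }
assert (Hunit : forall z, unit_disc z -> Cmod z < 1).
{ intros z Hz; unfold unit_disc, open_disc in Hz.
  now replace (z - 0)%C with z in Hz by ring. }
set (f := pseries a).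
assert (Hf : is_taylor_expansion f a).
{ intros z Hz; apply is_pseries_iff, (pseries_correct a 2); auto. }
assert (Hsum : forall n z, taylor_sum n f z = peval (truncation A (S n)) (t * z))
  by (intros n z; rewrite (taylor_sum_eq f a n z Hf); apply peval_truncation_scal).
set (c := RtoC 16).
assert (Hcl : forall z, closure (open_disc c 1) z <-> Cmod (z - c) <= 1)
  by (intros z; apply closure_open_disc; lra).
assert (Hcc : closure (open_disc c 1) c).
{ apply Hcl; replace (c - c)%C with (RtoC 0) by ring; rewrite Cmod_0; lra. }
exists f, c, 1; intros D; split; [|split; [|split; [|split; [|split]]]].
- intros z Hz; apply cdiff_ex_derive, (cdiff_pseries a 2); auto.
- lra.
- intros z Hz Hz'; apply Hunit in Hz'; unfold D, open_disc in Hz.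
  pose proof (Cmod_minus_le z (z - c)) as H.
  replace (z - (z - c))%C with c in H by ring.
  unfold c at 1 in H; rewrite Cmod_R, Rabs_pos_eq in H by lra; lra.
- intros g Hg eps He.
  destruct (polynomials_dense_in_A_disc c g (eps / 4) Hg ltac:(lra)) as [P HP].
  (* The approximant [P (z - 16)] expressed in [w], namely [P (16 w - 16)]. *)
  destruct (peval_comp_affine (- c) 16 P) as [p Hp].
  destruct (HA3 p (eps / 4) ltac:(lra)) as [n [sg [Hsg Hn]]].
  assert (Happ : forall z, closure D z -> Cmod (sg * taylor_sum n f z - g z) <= eps / 2).
  { intros z Hz; apply Hcl in Hz; specialize (HP z Hz).
    assert (Hw : Cmod (t * z - 1) <= / 16).
    { replace (t * z - 1)%C with (t * (z - c))%C by (rewrite <- Ht16; unfold c; ring).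
      rewrite Cmod_mult, Ht; lra. }
    specialize (Hn _ Hw); rewrite <- Hsum, Hp in Hn.
    replace (- c + 16 * (t * z))%C with (t * 16 * z - c)%C in Hn by ring.
    rewrite Ht16, Cmult_1_l in Hn.
    replace (sg * taylor_sum n f z - g z)%C
      with ((sg * taylor_sum n f z - peval P (z - c)) + (peval P (z - c) - g z))%C by ring.
    eapply Rle_trans; [apply Cmod_triangle|]; lra. }
  destruct Hsg as [-> | ->].
  + exists (taylor_sum n f); split; [left; now exists n|].
    apply sup_norm_lt with (eps / 2); [|lra].
    intros z Hz; rewrite <- (Cmult_1_l (taylor_sum n f z)); now apply Happ.
  + exists (taylor_sum n (fun z => (- f z)%C)); split; [right; now exists n|].
    apply sup_norm_lt with (eps / 2); [|lra].
    intros z Hz; rewrite (taylor_sum_opp f a n z Hf).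
    replace (- taylor_sum n f z - g z)%C with (- (1) * taylor_sum n f z - g z)%C by ring.
    now apply Happ.
- intros Hu.
  (* The constant [-3] is not approximable: at the centre of the disc the partial sum has an
     admissible value. For [- f] the constant is [3]. *)
  destruct (Hu (fun _ => (- (3))%C) (in_A_const _ _) 1 ltac:(lra)) as [h [[n ->] Hn]].
  apply lt_of_sup_norm_lt with (z := c) in Hn; [|exact Hcc].
  rewrite Hsum in Hn; unfold c in Hn; rewrite Ht16 in Hn.
  pose proof (admissible_far _ (HA2 (S n))) as Hfar.
  replace (peval (truncation A (S n)) 1 - - (3))%C
    with (peval (truncation A (S n)) 1 + 3)%C in Hn by ring; lra.
- intros Hu.
  destruct (Hu (fun _ => RtoC 3) (in_A_const _ _) 1 ltac:(lra)) as [h [[n ->] Hn]].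
  apply lt_of_sup_norm_lt with (z := c) in Hn; [|exact Hcc].
  rewrite (taylor_sum_opp f a n c Hf), Hsum in Hn; unfold c in Hn; rewrite Ht16 in Hn.
  pose proof (admissible_far _ (HA2 (S n))) as Hfar.
  replace (- peval (truncation A (S n)) 1 - 3)%C
    with (- (peval (truncation A (S n)) 1 + 3))%C in Hn by ring.
  rewrite Cmod_opp in Hn; lra.
Qed.
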